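(* Let $\mathbb{F}$ be a field and $n>1$ an integer. Then $n+1\leq \mathrm{TPN}(\mathrm{PGL}_n(\mathbb{F}))$, and $\mathrm{TCN}(\mathrm{PGL}_n(\mathbb{F}))\leq n+2$ for $|\mathbb{F}|>n^2$. In particular, if $\mathbb{F}$ is algebraically closed, then \[\mathrm{TPN}(\mathrm{PGL}_n(\mathbb{F}))=\frac{\dim(\mathrm{PGL}_n(\mathbb{F}))}{\operatorname{rank}(\mathrm{PGL}_n(\mathbb{F}))}=n+1, \quad\text{and}\quad \mathrm{TCN}(\mathrm{PGL}_n(\mathbb{F}))\in\{n+1,n+2\};\] analogously, if $\mathbb{F}=\mathbb{F}_q$ is finite (of order $q$), then \[\mathrm{TPN}(\mathrm{PGL}_n(\mathbb{F}_q))=n+1, \quad\text{and}\quad \mathrm{TCN}(\mathrm{PGL}_n(\mathbb{F}_q))=n+2 \ \text{ for } |\mathbb{F}|>n^2.\]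
   Context: $\mathrm{PGL}_n(\mathbb{F})=\mathrm{GL}_n(\mathbb{F})/\{\lambda I_n:\lambda\in\mathbb{F}^\times\}$. A split maximal torus of $\mathrm{PGL}_n(\mathbb{F})$ is a subgroup of the form $g^{-1}Dg$ with $g\in \mathrm{PGL}_n(\mathbb{F})$, where $D$ is the image in $\mathrm{PGL}_n(\mathbb{F})$ of the group of invertible diagonal matrices over $\mathbb{F}$; equivalently, it is the pointwise stabiliser of $n$ points of the projective space of $\mathbb{F}^n$ whose corresponding $1$-dimensional subspaces are linearly independent. As a group it is isomorphic to $(\mathbb{F}^\times)^{n-1}$. Let $G=\mathrm{PGL}_n(\mathbb{F})$. Split maximal tori $T_1,\dots,T_r$ of $G$ (not required to be distinct) induce a toric packing (respectively a toric covering) if the multiplication map $T_1\times\dots\times T_r\to G$, $(t_1,\dots,t_r)\mapsto t_1\cdots t_r$, is injective (respectively surjective). The toric packing number is $\mathrm{TPN}(G)=\max\{r\in\mathbb{N}: \text{some split maximal tori } T_1,\dots,T_r \text{ of } G \text{ induce a toric packing}\}$. The toric covering number is $\mathrm{TCN}(G)=\inf\{r\in\mathbb{N}: \text{some split maximal tori } T_1,\dots,T_r \text{ of } G \text{ induce a toric covering}\}$. For $\mathbb{F}$ algebraically closed, $\operatorname{rank}(G)$ is the dimension of a maximal torus of the algebraic group $G$. *)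

(* Defs.v *)
From HB Require Import structures.
From mathcomp Require Import -(notations) mpoly.
From mathcomp Require Import all_boot all_order all_algebra.
From mathcomp Require Import all_classical all_reals all_analysis.
From mathcomp Require Import Rstruct.
From Stdlib Require Rdefinitions.

Set Implicit Arguments.
Unset Strict Implicit.
Unset Printing Implicit Defensive.

Import Order.TTheory GRing.Theory Num.Theory.
Local Open Scope classical_set_scope.
Local Open Scope quotient_scope.
Local Open Scope ring_scope.

Local Notation R := Rdefinitions.R (only parsing).

(** * The group [GL_n(F)] *)

Record GL (F : fieldType) (n : nat) := MkGL {
  GLmx : 'M[F]_n;
  GLmx_unit : GLmx \in unitmx }.

Section GeneralLinear.
Variables (F : fieldType) (n : nat).

HB.instance Definition _ := [isSub for @GLmx F n].
HB.instance Definition _ := [Choice of GL F n by <:].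

Fact GL_one_unit : (1%:M : 'M[F]_n) \in unitmx. Proof. exact: unitmx1. Qed.
Definition GL_one : GL F n := MkGL GL_one_unit.

Fact GL_mul_unit (A B : GL F n) : GLmx A *m GLmx B \in unitmx.
Proof. by rewrite unitmx_mul !GLmx_unit. Qed.
Definition GL_mul (A B : GL F n) : GL F n := MkGL (GL_mul_unit A B).

Fact GL_inv_unit (A : GL F n) : invmx (GLmx A) \in unitmx.
Proof. by rewrite unitmx_inv GLmx_unit. Qed.
Definition GL_inv (A : GL F n) : GL F n := MkGL (GL_inv_unit A).

Fact GL_mulA : associative GL_mul.
Proof. by move=> A B C; apply: val_inj; rewrite /= mulmxA. Qed.
Fact GL_mul1 : left_id GL_one GL_mul.
Proof. by move=> A; apply: val_inj; rewrite /= mul1mx. Qed.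
Fact GL_mulr1 : right_id GL_one GL_mul.
Proof. by move=> A; apply: val_inj; rewrite /= mulmx1. Qed.
Fact GL_mulV : left_inverse GL_one GL_inv GL_mul.
Proof. by move=> A; apply: val_inj; rewrite /= mulVmx ?GLmx_unit. Qed.
Fact GL_mulrV : right_inverse GL_one GL_inv GL_mul.
Proof. by move=> A; apply: val_inj; rewrite /= mulmxV ?GLmx_unit. Qed.

HB.instance Definition _ := isGroup.Build (GL F n)
  GL_mulA GL_mul1 GL_mulr1 GL_mulV GL_mulrV.

(* Zariski topology: the open subsets are the unions of non-vanishing loci of
   polynomials in the [n * n] matrix entries. *)
Definition GL_eval (p : mpoly (n * n) F) (A : GL F n) : F :=
  meval (fun k => mxvec (GLmx A) 0 k) p.

Definition zariski_open : set_system (GL F n) :=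
  [set U | exists S : set (mpoly (n * n) F),
     U = [set A | exists2 p, S p & GL_eval p A != 0]].

Fact zariski_openT : zariski_open setT.
Proof.
exists setT; apply/seteqP; split=> // A _; exists 1 => //.
by rewrite /GL_eval meval1 oner_neq0.
Qed.

Fact zariski_openI : setI_closed zariski_open.
Proof.
move=> _ _ [S ->] [S' ->].
exists [set p * q | p in S & q in S'].
apply/seteqP; split=> A /=.
  move=> [[p Sp pA] [q Sq qA]]; exists (p * q); first by exists p => //; exists q.
  by rewrite /GL_eval mevalM mulf_neq0.
move=> [_ [p Sp [q Sq <-]]]; rewrite /GL_eval mevalM mulf_eq0 negb_or.
by move=> /andP[pA qA]; split; [exists p|exists q].
Qed.

Fact zariski_open_bigU (I : Type) (f : I -> set (GL F n)) :
  (forall i, zariski_open (f i)) -> zariski_open (\bigcup_i f i).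
Proof.
move=> fo.
exists [set p | exists i, [set A | GL_eval p A != 0] `<=` f i].
apply/seteqP; split=> A /=.
  move=> [i _]; have [S fE] := fo i; rewrite fE => -[p Sp pA].
  by exists p => //; exists i => B /= pB; rewrite fE; exists p.
by move=> [p [i pi] pA]; exists i => //; apply: pi.
Qed.

HB.instance Definition _ := isOpenTopological.Build (GL F n)
  zariski_openT zariski_openI zariski_open_bigU.

End GeneralLinear.

(** * The group [PGL_n(F)], quotient of [GL_n(F)] by the scalar matrices *)

Section ProjectiveLinear.
Variables (F : fieldType) (n : nat).

Definition PGL_equiv (A B : GL F n) : bool := is_scalar_mx (GLmx (A / B)%g).

Lemma PGL_equivP (A B : GL F n) :
  reflect (exists2 c : F, c != 0 & GLmx A = c *: GLmx B) (PGL_equiv A B).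
Proof.
apply: (iffP is_scalar_mxP) => /= -[c].
  move=> /(congr1 (mulmx^~ (GLmx B))).
  rewrite mulmxKV ?GLmx_unit// mul_scalar_mx => AE.
  have [c0|c0] := eqVneq c 0; last by exists c.
  case: (posnP n) => [n0|n0].
    exists 1; first exact: oner_neq0.
    apply/matrixP => i; suff: false by [].
    by have := leq_ltn_trans (leq0n _) (ltn_ord i); rewrite n0.
  by have := GLmx_unit A; rewrite AE c0 unitmxE detZ expr0n eqn0Ngt n0 mul0r unitr0.
move=> c0 AE; exists c.
by rewrite AE -scalemxAl mulmxV ?GLmx_unit// scalemx1.
Qed.

Fact PGL_equiv_refl : reflexive PGL_equiv.
Proof.
by move=> A; apply/PGL_equivP; exists 1; rewrite ?oner_neq0 ?scale1r.
Qed.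

Fact PGL_equiv_sym : symmetric PGL_equiv.
Proof.
have sub A B : PGL_equiv A B -> PGL_equiv B A.
  move=> /PGL_equivP[c c0 AE]; apply/PGL_equivP; exists c^-1.
    by rewrite invr_neq0.
  by rewrite AE scalerA mulVf ?scale1r.
by move=> A B; apply/idP/idP; exact: sub.
Qed.

Fact PGL_equiv_trans : transitive PGL_equiv.
Proof.
move=> B A C /PGL_equivP[c c0 AE] /PGL_equivP[d d0 BE].
by apply/PGL_equivP; exists (c * d); rewrite ?mulf_neq0// AE BE scalerA.
Qed.

Canonical PGL_equiv_rel :=
  EquivRel PGL_equiv PGL_equiv_refl PGL_equiv_sym PGL_equiv_trans.

(* [PGL] carries the quotient of the Zariski topology of [GL]. *)
Definition PGL := quotient_topology {eq_quot PGL_equiv_rel}.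
HB.instance Definition _ := Quotient.on PGL.
HB.instance Definition _ := Choice.on PGL.
HB.instance Definition _ := Topological.on PGL.

Definition PGL_pi (A : GL F n) : PGL := \pi_PGL A.

Lemma PGL_pi_eq (A B : GL F n) :
  PGL_pi A = PGL_pi B <-> exists2 c : F, c != 0 & GLmx A = c *: GLmx B.
Proof.
split=> [AB|/PGL_equivP AB].
  by apply/PGL_equivP; apply/(eqmodP PGL_equiv_rel).
by apply/(eqmodP PGL_equiv_rel).
Qed.

Definition PGL_one : PGL := PGL_pi 1%g.
Definition PGL_mul (x y : PGL) : PGL := PGL_pi (repr x * repr y)%g.
Definition PGL_inv (x : PGL) : PGL := PGL_pi (repr x)^-1%g.

Lemma PGL_piK (x : PGL) : PGL_pi (repr x) = x.
Proof. exact: reprK. Qed.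

Lemma PGL_pi_mul (A B : GL F n) : PGL_mul (PGL_pi A) (PGL_pi B) = PGL_pi (A * B)%g.
Proof.
have /PGL_pi_eq[c c0 cE] := PGL_piK (PGL_pi A).
have /PGL_pi_eq[d d0 dE] := PGL_piK (PGL_pi B).
apply/PGL_pi_eq; exists (c * d); first by rewrite mulf_neq0.
by rewrite /= cE dE -scalemxAl -scalemxAr scalerA.
Qed.

Lemma PGL_pi_inv (A : GL F n) : PGL_inv (PGL_pi A) = PGL_pi A^-1%g.
Proof.
have /PGL_pi_eq[c c0 cE] := PGL_piK (PGL_pi A).
apply/PGL_pi_eq; exists c^-1; first by rewrite invr_neq0.
by rewrite /= cE invmxZ // unitmxZ ?unitfE // GLmx_unit.
Qed.

Fact PGL_mulA : associative PGL_mul.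
Proof.
move=> x y z; rewrite -(PGL_piK x) -(PGL_piK y) -(PGL_piK z).
by rewrite !PGL_pi_mul mulgA.
Qed.
Fact PGL_mul1 : left_id PGL_one PGL_mul.
Proof. by move=> x; rewrite -(PGL_piK x) PGL_pi_mul mul1g. Qed.
Fact PGL_mulr1 : right_id PGL_one PGL_mul.
Proof. by move=> x; rewrite -(PGL_piK x) PGL_pi_mul mulg1. Qed.
Fact PGL_mulV : left_inverse PGL_one PGL_inv PGL_mul.
Proof. by move=> x; rewrite -(PGL_piK x) PGL_pi_inv PGL_pi_mul mulVg. Qed.
Fact PGL_mulrV : right_inverse PGL_one PGL_inv PGL_mul.
Proof. by move=> x; rewrite -(PGL_piK x) PGL_pi_inv PGL_pi_mul mulgV. Qed.

HB.instance Definition _ := isGroup.Build PGL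
  PGL_mulA PGL_mul1 PGL_mulr1 PGL_mulV PGL_mulrV.

End ProjectiveLinear.

(** * Split maximal tori, toric packings and coverings *)

Section Toric.
Variables (F : fieldType) (n : nat).

Definition diag_torus : set (PGL F n) :=
  @PGL_pi F n @` [set A | is_diag_mx (GLmx A)].

(* [conjg t g] is [g^-1 * t * g]. *)
Definition split_maximal_torus (T : set (PGL F n)) : Prop :=
  exists g : PGL F n, T = [set conjg t g | t in diag_torus].

Definition torus_product (r : nat) (T : 'I_r -> set (PGL F n)) :
    set {ffun 'I_r -> PGL F n} :=
  [set t | forall i, T i (t i)].

Definition mul_map (r : nat) (t : {ffun 'I_r -> PGL F n}) : PGL F n :=
  (\prod_(i < r) t i)%g.

Definition toric_packing (r : nat) (T : 'I_r -> set (PGL F n)) : Prop :=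
  (forall i, split_maximal_torus (T i)) /\
  set_inj (torus_product T) (@mul_map r).

Definition toric_covering (r : nat) (T : 'I_r -> set (PGL F n)) : Prop :=
  (forall i, split_maximal_torus (T i)) /\
  set_surj (torus_product T) setT (@mul_map r).

(* The maximum of the set of lengths of toric packings if this set is bounded,
   and [+oo] otherwise (for instance if [F] has two elements, as all the tori
   are then trivial). *)
Definition TPN : \bar R :=
  ereal_sup [set r%:R%:E | r in
    [set r : nat | exists T : 'I_r -> set (PGL F n), toric_packing T]].

Definition TCN : \bar R :=
  ereal_inf [set r%:R%:E | r in
    [set r : nat | exists T : 'I_r -> set (PGL F n), toric_covering T]].

End Toric.

(** * Dimension *)

Section KrullDimension.
Variable T : topologicalType.

Definition irreducible_set (Z : set T) : Prop :=
  Z !=set0 /\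
  forall B C : set T, closed B -> closed C ->
    Z `<=` B `|` C -> Z `<=` B \/ Z `<=` C.

(* Krull dimension of the subspace [X]: the supremum of the lengths [d] of the
   chains [Z_0 < ... < Z_d] of irreducible relatively closed subsets of [X]. *)
Definition krull_dim (X : set T) : \bar R :=
  ereal_sup [set d%:R%:E | d in
    [set d : nat | exists Z : nat -> set T,
       (forall i, (i <= d)%N ->
          irreducible_set (Z i) /\ exists2 C, closed C & Z i = C `&` X) /\
       (forall i, (i < d)%N -> Z i `<` Z i.+1)]].

End KrullDimension.

(* Main.v *)
(* Packing and covering. Let p_0, ..., p_n be a projective frame of F^n (row
   vectors, matrices acting on the right) and let T_i be the torus fixing the
   lines p_j with j <> i. An element fixing all n + 1 lines is trivial, so
   t_0 ... t_n, whose effect on p_n only depends on t_n, determines t_n, then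
   t_(n-1), and so on. An element g is a product t_0 ... t_n as soon as all the
   mixed configurations (p_0, ..., p_(i-1), p_i g, ..., p_n g) are frames: if G_i
   carries the p_j to the i-th configuration then G_i G_(i+1)^-1 lies in T_i.
   When the p_j are the rows of a Cauchy matrix, every g can be brought into
   this situation by a diagonal matrix, which has to avoid the zeros of n^2
   nonzero multiaffine determinants.

   Dimension. If X < Y are irreducible, p vanishes on X but not on Y, and
   monomials m_e are linearly independent on X, then the p^j m_e are linearly
   independent on Y. Hence a chain of length d gives M^d independent
   polynomials of degree O(M), and d <= k if the chain lies in the image of a
   polynomial map from F^k. This computes the Krull dimensions and bounds TCN
   from below. For TPN over an algebraically closed field, a polynomial map
   from (F - {0})^k to F^N with N < k is not injective: some two consecutive
   coordinate subtori have images with the same closure, and by quantifier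
   elimination these images overlap. Over a finite field one counts. *)

Require Import Defs.
From HB Require Import structures.
From mathcomp Require Import -(notations) mpoly.
From mathcomp Require Import all_boot all_order perm all_algebra.
From mathcomp Require Import closed_field.
From mathcomp Require Import all_classical all_reals all_analysis.
From mathcomp Require Import Rstruct.
From mathcomp Require Import zify.

Set Implicit Arguments.
Unset Strict Implicit.
Unset Printing Implicit Defensive.

Import Order.TTheory GRing.Theory Num.Theory.
Local Open Scope classical_set_scope.
Local Open Scope card_scope.
Local Open Scope ring_scope.

(** * Polynomial functions over an infinite field *)

Section PolynomialSets.
Variable F : fieldType.

Lemma infinite_notin (s : seq F) : infinite_set [set: F] -> exists x, x \notin s.
Proof.
move=> Finf; apply: contrapT => /forallNP sP; apply: Finf.
apply: (sub_finite_set _ (finite_seq s)) => x _ /=.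
by apply: contrapT => /negP; exact: sP.
Qed.

Lemma infinite_uniq_seq N : infinite_set [set: F] ->
  exists s : seq F, uniq s /\ size s = N.
Proof.
move=> Finf; elim: N => [|N [s [us sN]]]; first by exists [::].
by have [x xs] := infinite_notin s Finf; exists (x :: s); rewrite /= xs sN.
Qed.

Lemma infinite_poly_eq0 (q : {poly F}) : infinite_set [set: F] ->
  (forall c, q.[c] = 0) -> q = 0.
Proof.
move=> Finf q0; apply/eqP/negPn/negP => qN0.
have [s [us sz]] := infinite_uniq_seq (size q) Finf.
have /(max_poly_roots qN0)/(_ us) : all (root q) s.
  by apply/allP => c _; rewrite rootE q0.
by rewrite sz ltnn.
Qed.

(** A monomial is determined by its last exponent and its truncation to the other variables, so
    distinct terms of [p] cannot cancel in [muni p]. *)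
Lemma muni_eq0 n (p : mpoly n.+1 F) : muni p = 0 -> p = 0.
Proof.
move=> p0; apply/mpolyP => m0; rewrite mcoeff0.
have [//|m0p] := eqVneq (mcoeff m0 p) 0.
pose m1 : multinom n := Multinom [tuple m0 (widen_ord (leqnSn n) i) | i < n].
have /(congr1 (fun q : {poly mpoly n F} => mcoeff m1 q`_(m0 ord_max))) := p0.
rewrite coef0 mcoeff0 muniE coef_sum raddf_sum /=.
have m0s : m0 \in msupp p by rewrite mcoeff_msupp.
rewrite (big_rem m0) //= big_seq big1 => [|m]; last first.
  rewrite mem_rem_uniq ?msupp_uniq // inE => /andP[mm0 _].
  rewrite coefZ coefXn; case: eqP => [e|_]; last by rewrite mulr0 mcoeff0.
  rewrite mulr1 mcoeffZ mcoeffX; case: eqP => [e'|_]; last by rewrite mulr0.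
  case/eqP: mm0; apply/mnmP => i.
  case: (unliftP ord_max i) => [j ->|-> //].
  move/mnmP/(_ j): e'; rewrite !multinomE !tnth_mktuple.
  suff -> : widen_ord (leqnSn n) j = lift ord_max j by [].
  by apply/val_inj; rewrite /= /bump leqNgt ltn_ord.
by rewrite addr0 coefZ coefXn eqxx mulr1 mcoeffZ mcoeffX eqxx mulr1.
Qed.

Lemma meval_muni n (p : mpoly n.+1 F) (x : 'I_n -> F) (c : F) :
  (map_poly (meval x) (muni p)).[c] =
  meval (fun i => if unlift ord_max i is Some j then x j else c) p.
Proof.
rewrite muniE rmorph_sum horner_sum mevalE; apply: eq_bigr => m _ /=.
rewrite -!mul_polyC !rmorphM /= map_polyC map_polyXn hornerM hornerXn hornerC.
rewrite /= mevalZ mevalX -mulrA big_ord_recr /= unlift_none; congr (_ * (_ * _)).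
apply: eq_bigr => i _; rewrite mnmE.
suff -> : widen_ord (leqnSn n) i = lift ord_max i by rewrite liftK.
by apply/val_inj; rewrite /= /bump leqNgt ltn_ord.
Qed.

(** Induction on [n]: once the first variables are fixed, [muni p] becomes a univariate polynomial
    vanishing on an infinite field, so each of its coefficients vanishes at every point. *)
Lemma mpoly_eq0_infinite n (p : mpoly n F) : infinite_set [set: F] ->
  (forall x, meval x p = 0) -> p = 0.
Proof.
move=> Finf; elim: n p => [|n IHn] p p0.
  have pC : p = mpolyC 0 (mcoeff mnm0 p).
    apply/mpolyP => m; rewrite mcoeffC.
    have -> : m = mnm0 by apply/mnmP => -[].
    by rewrite eqxx mulr1.
  by have := p0 (fun=> 0); rewrite pC mevalC => ->; rewrite mpolyC0.
apply: muni_eq0; apply/polyP => j; rewrite coef0; apply: IHn => x.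
rewrite -(coef_map (meval x)) [map_poly _ _]infinite_poly_eq0 ?coef0 // => c.
by rewrite meval_muni.
Qed.

End PolynomialSets.

(** * Chains of irreducible sets in the image of a polynomial map *)

Section Dimension.
Variable F : fieldType.

Definition polymap k N (f : ('I_k -> F) -> 'I_N -> F) : Prop :=
  forall j, exists p : mpoly k F, forall x, f x j = meval x p.

Definition vanish N (p : mpoly N F) (Z : set ('I_N -> F)) : Prop :=
  forall x, Z x -> meval x p = 0.

(** The vanishing ideal of [Z] is prime or the unit ideal; for nonempty [Z] this is irreducibility
    of its Zariski closure. *)
Definition prime_set N (Z : set ('I_N -> F)) : Prop :=
  forall p q, vanish (p * q) Z -> vanish p Z \/ vanish q Z.

Lemma polymap_pullback k N (f : ('I_k -> F) -> 'I_N -> F) : polymap f ->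
  exists t : N.-tuple (mpoly k F),
    forall x p, meval x (comp_mpoly t p) = meval (f x) p.
Proof.
move=> /choice[g gP]; exists [tuple g j | j < N] => x p.
by rewrite comp_mpoly_meval; apply: meval_eq => j; rewrite tnth_mktuple gP.
Qed.

Lemma polymap_comp k N L (g : ('I_N -> F) -> 'I_L -> F) (f : ('I_k -> F) -> 'I_N -> F) :
  polymap g -> polymap f -> polymap (g \o f).
Proof.
move=> gP /polymap_pullback[t tP] j; have [p pP] := gP j.
by exists (comp_mpoly t p) => x; rewrite tP /= pP.
Qed.

(** The product of [h] and the pullbacks of [p] and [q] vanishes at every point, hence is zero in an
    integral domain. *)
Lemma prime_image k N (f : ('I_k -> F) -> 'I_N -> F) (h : mpoly k F) :
  infinite_set [set: F] -> polymap f -> h != 0 ->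
  prime_set (f @` [set x | meval x h != 0]).
Proof.
move=> Finf /polymap_pullback[t tP] h0 p q pq0.
have : comp_mpoly t p * comp_mpoly t q * h = 0.
  apply: mpoly_eq0_infinite => // x; rewrite !mevalM !tP.
  have [->|hx] := eqVneq (meval x h) 0; first by rewrite mulr0.
  by rewrite -mevalM pq0 ?mul0r //; exists x.
move/eqP; rewrite !mulf_eq0 (negbTE h0) orbF => /orP[]/eqP e; [left|right].
  by move=> _ [x _ <-]; rewrite -tP e meval0.
by move=> _ [x _ <-]; rewrite -tP e meval0.
Qed.

Definition linindep N (E : finType) (m : E -> mpoly N F) (Z : set ('I_N -> F)) : Prop :=
  forall c : E -> F, vanish (\sum_e c e *: m e) Z -> forall e, c e = 0.

(* On X only the constant term of the relation survives; once it is known to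
   be zero, primality of Y lets us divide the relation by p. *)
Lemma linindep_step N (E : finType) (m : E -> mpoly N F) (X Y : set ('I_N -> F))
    (p : mpoly N F) M (c : nat -> E -> F) :
  linindep m X -> X `<=` Y -> prime_set Y -> vanish p X -> ~ vanish p Y ->
  vanish (\sum_(j < M) p ^+ j * \sum_e c j e *: m e) Y ->
  forall j e, (j < M)%N -> c j e = 0.
Proof.
move=> mX XY Yp pX pY; elim: M c => // M IHM c.
rewrite big_ord_recl expr0 mul1r.
under [X in vanish (_ + X)]eq_bigr do rewrite lift0 exprS -mulrA.
rewrite -mulr_sumr => vc.
have c0 e : c 0%N e = 0.
  apply: mX => x Xx; have := vc x (XY _ Xx).
  by rewrite mevalD mevalM pX // mul0r addr0.
move: vc; rewrite big1 ?add0r => [/Yp[//|]|e _]; last by rewrite c0 scale0r.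
move=> /(IHM (fun j => c j.+1)) IH [|j] e; first by rewrite c0.
exact: IH.
Qed.

Lemma msize_exp_mul k (p q : mpoly k F) j :
  (msize (p ^+ j * q) <= j * (msize p).+1 + msize q)%N.
Proof.
elim: j => [|j IHj]; first by rewrite expr0 mul1r.
rewrite exprS -mulrA; apply: leq_trans (msizeM_le _ _) _.
by rewrite mulSn -addSn -addnA leq_add2l.
Qed.

(** Each step multiplies the family by the first [M] powers of a polynomial separating two
    consecutive sets. Sizes after pullback along [t] stay linear in [M], with a slope [D] fixed
    before [M]. *)
Lemma chain_linindep d N (Z : nat -> set ('I_N -> F)) k (t : N.-tuple (mpoly k F)) :
  Z 0%N !=set0 ->
  (forall i, (0 < i <= d)%N -> prime_set (Z i)) ->
  (forall i, (i < d)%N -> Z i `<=` Z i.+1) ->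
  (forall i, (i < d)%N -> exists p, vanish p (Z i) /\ ~ vanish p (Z i.+1)) ->
  exists D, forall M, exists (E : finType) (m : E -> mpoly N F),
    [/\ #|E| = (M ^ d)%N, linindep m (Z d) &
        forall e, (msize (comp_mpoly t (m e)) <= D * M + 1)%N].
Proof.
move=> Z0; elim: d => [|d IHd] Zp ZS Zlt.
  exists 0%N => M; exists unit, (fun=> 1); split=> [|c|e].
  - by rewrite card_unit.
  - case: Z0 => x /[swap] v /v; rewrite (big_pred1 tt) => [|[] //].
    by rewrite mevalZ meval1 mulr1 => c0 [].
  - by rewrite comp_mpoly1 msize1.
have [] := IHd.
- by move=> i /andP[i0 /leqW id]; apply: Zp; rewrite i0.
- by move=> i /leqW; exact: ZS.
- by move=> i /leqW; exact: Zlt.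
move=> D DP; have [p [pX pY]] := Zlt d (ltnSn d).
exists (D + (msize (comp_mpoly t p)).+1)%N => M.
have [E [m [cE mi ms]]] := DP M.
exists (('I_M * E)%type : finType), (fun je : 'I_M * E => p ^+ je.1 * m je.2); split.
- by rewrite card_prod card_ord cE expnS.
- move=> c vc [j e].
  (* [c'] extends [c] by zero, since [linindep_step] takes coefficients indexed by [nat]. *)
  pose c' i e := if insub i is Some j then c (j, e) else 0.
  have c'E (i : 'I_M) e' : c' i e' = c (i, e').
    by rewrite /c' insubT //= => iM; congr (c (_, _)); exact: val_inj.
  rewrite -c'E; apply: (linindep_step mi _ _ pX pY) => //.
  + exact: ZS.
  + by apply: Zp; rewrite ltnSn.
  move=> x Zx; rewrite -[RHS](vc x Zx); congr meval.
  under [LHS]eq_bigr => i _ do rewrite mulr_sumr.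
  rewrite pair_bigA /=; apply: eq_bigr => -[i e'] _ /=.
  by rewrite c'E scalerAr.
move=> [j e] /=; rewrite rmorphM rmorphXn /=.
apply: leq_trans (msize_exp_mul _ _ _) _.
rewrite mulnDl addnAC addnC leq_add // mulnC leq_mul2l ltnW ?orbT //.
Qed.

Lemma card_bmultinom k L : (#|{: bmultinom k L}| <= L ^ k)%N.
Proof.
have ltL (m : bmultinom k L) (i : 'I_k) : (bmnm m i < L)%N.
  by apply: leq_ltn_trans (bmdeg m); rewrite mdegE (bigD1 i) //= leq_addr.
pose f (m : bmultinom k L) : {ffun 'I_k -> 'I_L} := [ffun i => Ordinal (ltL m i)].
suff /leq_card : injective f by rewrite card_ffun !card_ord.
move=> m m' /ffunP mm'; apply/val_inj/mnmP => i.
by have := mm' i; rewrite !ffunE => -[].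
Qed.

(** A left kernel vector of the coefficient matrix of the pullbacks is a linear relation among the
    [m e] on the range of [f], hence on [Z]. So the rows are free, and there are at most as many as
    monomials of degree below [L]. *)
Lemma linindep_card N (E : finType) (m : E -> mpoly N F) (Z : set ('I_N -> F))
    k (t : N.-tuple (mpoly k F)) (f : ('I_k -> F) -> 'I_N -> F) L :
  (forall x p, meval x (comp_mpoly t p) = meval (f x) p) ->
  Z `<=` range f -> linindep m Z ->
  (forall e, (msize (comp_mpoly t (m e)) <= L)%N) -> (#|E| <= L ^ k)%N.
Proof.
move=> tP Zf mi mL; apply: leq_trans (card_bmultinom k L).
pose A : 'M[F]_(#|E|, #|{: bmultinom k L}|) :=
  \matrix_(i, j) mcoeff (bmnm (enum_val j : bmultinom k L)) (comp_mpoly t (m (enum_val i))).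
have [/eqP <-|Af] := boolP (row_free A); first exact: rank_leq_col.
have /rowV0Pn[u uA u0] : kermx A != 0 by rewrite kermx_eq0.
case/negP: u0; apply/eqP/rowP => i; rewrite mxE -[i]enum_valK.
apply: (mi (fun e => u 0 (enum_rank e))) => x /Zf[y _ <-].
rewrite -tP (_ : comp_mpoly _ _ = 0) ?meval0 // (raddf_sum (comp_mpoly t)).
under eq_bigr => e _.
  rewrite /= comp_mpolyZ (mpolywE (mL e)) scaler_sumr.
  under eq_bigr do rewrite scalerA.
  over.
rewrite exchange_big big1 //= => b _; rewrite -scaler_suml.
move/sub_kermxP/rowP/(_ (enum_rank b)): uA; rewrite !mxE => uA.
rewrite (_ : \sum_i _ = 0) ?scale0r // -[RHS]uA (reindex _ (onW_bij _ (@enum_val_bij E))) /=.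
by apply: eq_bigr => j _; rewrite mxE !enum_rankK enum_valK.
Qed.

Lemma chain_length d k N (f : ('I_k -> F) -> 'I_N -> F) (Z : nat -> set ('I_N -> F)) :
  polymap f -> Z d `<=` range f -> Z 0%N !=set0 ->
  (forall i, (0 < i <= d)%N -> prime_set (Z i)) ->
  (forall i, (i < d)%N -> Z i `<=` Z i.+1) ->
  (forall i, (i < d)%N -> exists p, vanish p (Z i) /\ ~ vanish p (Z i.+1)) ->
  (d <= k)%N.
Proof.
move=> /polymap_pullback[t tP] Zf Z0 Zp ZS Zlt.
have [D DP] := chain_linindep t Z0 Zp ZS Zlt.
(* [M] exceeds [(D + 1)^k], so [(D * M + 1)^k <= ((D + 1) * M)^k < M^(k + 1) <= M^d], against the
   count of independent polynomials. *)
rewrite leqNgt; apply/negP => kd; pose M := ((D.+1) ^ k).+1.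
have [E [m [cE mi ms]]] := DP M.
have := linindep_card tP Zf mi ms; rewrite cE leqNgt => /negP; apply.
have M0 : (0 < M)%N by [].
apply: (@leq_ltn_trans ((D.+1 * M) ^ k)%N).
  case: (posnP k) => [->|k0]; first by rewrite !expn0.
  by rewrite leq_exp2r // mulSn addnC leq_add2r.
apply: (@leq_trans (M ^ k.+1)%N); last by rewrite leq_pexp2l.
by rewrite expnMn expnS ltn_mul2r expn_gt0 M0 /M ltnSn.
Qed.

End Dimension.

(** * Chevalley's theorem and non-injectivity *)

Section ChevalleyImage.
Variable F : fieldType.

Definition env N (y : 'I_N -> F) : seq F := [seq y i | i <- enum 'I_N].

Lemma nth_env N (y : 'I_N -> F) (i : 'I_N) : (env y)`_i = y i.
Proof. by rewrite (nth_map i) ?size_enum_ord // nth_ord_enum. Qed.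

Lemma eval_rterm N (t : GRing.term F) : GRing.rterm t ->
  exists p : mpoly N F, forall y, GRing.eval (env y) t = meval y p.
Proof.
elim: t => //=.
- move=> i _; have [iN|Ni] := ltnP i N.
    exists (mpolyX F (mnm1 (Ordinal iN))) => y.
    by rewrite mevalXU -[RHS]nth_env.
  by exists 0 => y; rewrite nth_default ?meval0 // size_map size_enum_ord.
- by move=> c _; exists (mpolyC N c) => y; rewrite mevalC.
- by move=> j _; exists j%:R => y; rewrite rmorph_nat.
- move=> t1 IH1 t2 IH2 /andP[/IH1[p1 E1] /IH2[p2 E2]].
  by exists (p1 + p2) => y; rewrite mevalD E1 E2.
- by move=> t1 IH1 /IH1[p1 E1]; exists (- p1) => y; rewrite mevalN E1.
- by move=> t1 IH1 j /IH1[p1 E1]; exists (p1 *+ j) => y; rewrite mevalMn E1.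
- move=> t1 IH1 t2 IH2 /andP[/IH1[p1 E1] /IH2[p2 E2]].
  by exists (p1 * p2) => y; rewrite mevalM E1 E2.
- by move=> t1 IH1 j /IH1[p1 E1]; exists (p1 ^+ j) => y; rewrite rmorphXn E1.
Qed.

(** A quantifier-free formula has a generic truth value on [Y]: an equation either holds throughout
    [Y] or fails wherever the difference of its sides is nonzero, and primality allows the
    polynomials for subformulas to be multiplied. *)
Lemma qf_generic N (Y : set ('I_N -> F)) (f : GRing.formula F) :
  Y !=set0 -> prime_set Y -> GRing.qf_form f -> GRing.rformula f ->
  exists (g : mpoly N F) (b : bool), ~ vanish g Y /\
    forall y, Y y -> meval y g != 0 -> GRing.qf_eval (env y) f = b.
Proof.
move=> Y0 Yp; have v1 : ~ vanish (1 : mpoly N F) Y.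
  by case: Y0 => y Yy /(_ _ Yy)/eqP; rewrite meval1 oner_eq0.
have two (op : bool -> bool -> bool) (q1 q2 : ('I_N -> F) -> bool) :
    (exists (g : mpoly N F) (b : bool), ~ vanish g Y /\
       forall y, Y y -> meval y g != 0 -> q1 y = b) ->
    (exists (g : mpoly N F) (b : bool), ~ vanish g Y /\
       forall y, Y y -> meval y g != 0 -> q2 y = b) ->
    exists (g : mpoly N F) (b : bool), ~ vanish g Y /\
       forall y, Y y -> meval y g != 0 -> op (q1 y) (q2 y) = b.
  move=> [g1 [b1 [v1' E1]]] [g2 [b2 [v2' E2]]].
  exists (g1 * g2), (op b1 b2); split; first by move/Yp => [].
  move=> y Yy; rewrite mevalM mulf_eq0 negb_or => /andP[n1 n2].
  by rewrite E1 // E2.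
elim: f => //=.
- by move=> b _ _; exists 1, b.
- move=> t1 t2 _ /andP[/(eval_rterm N)[p1 E1] /(eval_rterm N)[p2 E2]].
  have [v|nv] := pselect (vanish (p1 - p2) Y).
    exists 1, true; split => // y Yy _; rewrite E1 E2.
    by have /eqP := v y Yy; rewrite mevalB subr_eq0.
  exists (p1 - p2), false; split => // y Yy.
  by rewrite E1 E2 mevalB subr_eq0 => /negbTE.
- by move=> f1 IH1 f2 IH2 /andP[? ?] /andP[? ?]; apply: two; [exact: IH1|exact: IH2].
- by move=> f1 IH1 f2 IH2 /andP[? ?] /andP[? ?]; apply: two; [exact: IH1|exact: IH2].
- by move=> f1 IH1 f2 IH2 /andP[? ?] /andP[? ?];
    apply: (two (fun a b => a ==> b)); [exact: IH1|exact: IH2].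
- move=> f1 IH1 q r; have [g [b [vg E]]] := IH1 q r.
  by exists g, (~~ b); split => // y Yy gy; rewrite E.
Qed.

(** The shift by [N] reserves the first [N] variables for the point of the image; the next [k] hold
    its preimage. *)
Lemma mpoly_term k N (p : mpoly k F) :
  exists t : GRing.term F, forall e, GRing.eval e t = meval (fun i => e`_(N + i)) p.
Proof.
rewrite [p]mpolyE; set P := fun q : mpoly k F => exists t : GRing.term F,
  forall e, GRing.eval e t = meval (fun i => e`_(N + i)) q.
apply: (big_ind P).
- by exists (GRing.Const 0) => e; rewrite meval0.
- by move=> p1 p2 [t1 E1] [t2 E2]; exists (GRing.Add t1 t2) => e; rewrite mevalD /= E1 E2.
move=> m _; suff [t E] : P (mpolyX F m).
  by exists (GRing.Mul (GRing.Const (mcoeff m p)) t) => e; rewrite mevalZ /= E.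
rewrite mpolyXE_id; apply: (big_ind P).
- by exists (GRing.Const 1) => e; rewrite meval1.
- by move=> p1 p2 [t1 E1] [t2 E2]; exists (GRing.Mul t1 t2) => e; rewrite mevalM /= E1 E2.
move=> i _; exists (GRing.Exp (GRing.Var F (N + i)) (m i)) => e.
by rewrite rmorphXn /= mevalXU.
Qed.

Lemma holds_all (I : eqType) (s : seq I) (g : I -> GRing.formula F) e :
  GRing.holds e (foldr (fun i => GRing.And (g i)) (@GRing.Bool F true) s) <->
  (forall i, i \in s -> GRing.holds e (g i)).
Proof.
elim: s => [|a s IHs] /=; first by split.
rewrite IHs; split => [[ga gs] i|gs].
  by rewrite inE => /orP[/eqP ->|/gs].
by split => [|i si]; apply: gs; rewrite inE ?eqxx ?si ?orbT.
Qed.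

(* Chevalley: by quantifier elimination the image W of a basic open set is
   constructible, hence contains a nonempty open subset of its closure. *)
Lemma image_contains_open k N (f : ('I_k -> F) -> 'I_N -> F) (h : mpoly k F) :
  GRing.closed_field_axiom F -> infinite_set [set: F] -> polymap f -> h != 0 ->
  let W := f @` [set x | meval x h != 0] in
  exists g, ~ vanish g W /\
    forall y, (forall p, vanish p W -> meval y p = 0) -> meval y g != 0 -> W y.
Proof.
move=> Fcl Finf fP h0 W; have Wp : prime_set W := prime_image Finf fP h0.
(* [Y] is the Zariski closure of [W]. *)
pose Y := [set y | forall p, vanish p W -> meval y p = 0].
have WY : W `<=` Y by move=> y Wy p; apply.
have vY p : vanish p Y <-> vanish p W.
  by split => v y; [move/WY; exact: v|apply; exact: v].
have Yp : prime_set Y by move=> p q; rewrite !vY => /Wp.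
have W0 : W !=set0.
  apply: contrapT => W0; move/eqP: h0; apply.
  apply: mpoly_eq0_infinite => // x; apply/eqP/negPn/negP => hx.
  by apply: W0; exists (f x), x.
have [p /= pP] := choice fP.
have [t tP] := choice (fun j => mpoly_term N (p j)).
have [th thP] := mpoly_term N h.
(* Once the last [k] variables are quantified existentially, this says that the point held by the
   first [N] variables lies in [W]. *)
pose body := GRing.And (GRing.Not (GRing.Equal th (GRing.Const 0)))
  (foldr (fun i : 'I_N => GRing.And (GRing.Equal (t i) (GRing.Var F i)))
     (@GRing.Bool F true) (enum 'I_N)).
pose phi := GRing.to_rform (foldr GRing.Exists body (iota N k)).
have phiP y : GRing.holds (env y) phi <-> W y.
  rewrite GRing.to_rformP; split.
    move=> /GRing.foldExistsP[e ye [/= /eqP he /holds_all ee]].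
    exists (fun i => e`_(N + i)); first by rewrite /= -thP.
    apply/funext => j; rewrite pP -tP.
    have /= -> := ee j (mem_enum _ _); rewrite -ye ?nth_env //.
    by rewrite inE mem_iota negb_and -ltnNge ltn_ord.
  move=> [x /= hx xy]; apply/GRing.foldExistsP.
  pose e := env y ++ env x.
  have sy : size (env y) = N by rewrite size_map size_enum_ord.
  have eE : (fun i : 'I_k => e`_(N + i)) = x.
    by apply/funext => i; rewrite nth_cat sy ltnNge leq_addr addKn nth_env.
  exists e.
    move=> i; rewrite inE mem_iota negb_and -ltnNge -leqNgt => /orP[iN|ki].
      by rewrite nth_cat sy iN.
    rewrite !nth_default // ?size_cat sy.
      by rewrite size_map size_enum_ord.
    exact: leq_trans (leq_addr _ _) ki.
  split => /=; first by rewrite thP eE; apply/eqP.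
  apply/holds_all => j _ /=; rewrite tP eE -pP xy.
  by rewrite nth_cat sy ltn_ord nth_env.
have rphi : GRing.rformula phi by exact: GRing.to_rform_rformula.
have wf := @ClosedFieldQE.wf_ex_elim F.
have ok := ClosedFieldQE.holds_ex_elim Fcl.
have /andP[qq qr] := GRing.quantifier_elim_wf wf rphi.
have qP y := GRing.quantifier_elim_rformP wf ok (env y) rphi.
have [g [b [vg gP]]] := qf_generic (subset_nonempty WY W0) Yp qq qr.
rewrite vY in vg; exists g; split=> // y Yy gy.
(* The generic truth value is true, since [g] is nonzero at some point of [W], where [phi] holds. *)
suff bt : b = true by apply/phiP/qP; rewrite gP.
move/existsNP: vg => [z /not_implyP[Wz /eqP gz]].
by rewrite -(gP z (WY _ Wz) gz); apply/qP/phiP.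
Qed.

End ChevalleyImage.

(** * Polynomial maps from a torus to an affine space of smaller dimension *)

Section NoInjectivePolynomialMap.
Variable F : fieldType.

Definition coordprod k : mpoly k F := \prod_(j < k) mpolyX F (mnm1 j).

Lemma meval_coordprod k (x : 'I_k -> F) :
  (meval x (coordprod k) != 0) = [forall j, x j != 0].
Proof.
rewrite rmorph_prod /=; apply/prodf_neq0/forallP => x0 j //.
  by have := x0 j isT; rewrite mevalXU.
by move=> _; rewrite mevalXU.
Qed.

Lemma coordprod_neq0 k : coordprod k != 0.
Proof.
apply/eqP => h0; have := meval_coordprod (fun _ : 'I_k => 1).
rewrite h0 meval0 eqxx => /esym/forallP[] j; exact: oner_neq0.
Qed.

Definition freeze k i (x : 'I_k -> F) : 'I_k -> F := fun j => if (j < i)%N then x j else 1.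

Lemma polymap_freeze k i : polymap (@freeze k i).
Proof.
move=> j; exists (if (j < i)%N then mpolyX F (mnm1 j) else 1) => x.
by rewrite /freeze; case: ifP; rewrite ?mevalXU ?meval1.
Qed.

Lemma freezeS k i (x : 'I_k -> F) : freeze i.+1 (freeze i x) = freeze i x.
Proof.
apply/funext => j; rewrite /freeze; case: (ltnP j i) => [ji|_]; last by rewrite if_same.
by rewrite leqW.
Qed.

(* Freezing ever fewer coordinates to 1 gives k + 1 tori of dimensions
   0, ..., k. The closures of their images cannot all be distinct if N < k, so
   for some i freeing the i-th coordinate does not enlarge the closure; then
   the points with i-th coordinate different from 1 already cover a nonempty
   open part of that closure, which meets the image of the smaller torus. *)
Lemma no_injective_polymap k N (f : ('I_k -> F) -> 'I_N -> F) :
  GRing.closed_field_axiom F -> infinite_set [set: F] -> polymap f -> (N < k)%N ->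
  exists x y, [/\ forall j, x j != 0, forall j, y j != 0, x <> y & f x = f y].
Proof.
move=> Fcl Finf fP Nk.
pose h := coordprod k.
pose Z i := (f \o freeze i) @` [set x | meval x h != 0].
have ZP i : polymap (f \o @freeze k i) by apply: polymap_comp; last exact: polymap_freeze.
have Zfreeze i x : (forall j, x j != 0) -> Z i (f (freeze i x)).
  by move=> x0; exists x => //=; rewrite meval_coordprod; apply/forallP.
have freeze0 i (x : 'I_k -> F) : (forall j, x j != 0) -> forall j, freeze i x j != 0.
  by move=> x0 j; rewrite /freeze; case: ifP => _; rewrite ?oner_neq0.
have [i ik iP] : exists2 i, (i < k)%N & forall p, vanish p (Z i) -> vanish p (Z i.+1).
  apply: contrapT => nP; move: Nk; rewrite ltnNge => /negP; apply.
  apply: (@chain_length F k N N id Z).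
  - by move=> j; exists (mpolyX F (mnm1 j)) => x; rewrite mevalXU.
  - by move=> y _; exists y.
  - by exists (f (freeze 0 (fun=> 1))); apply: Zfreeze => j; exact: oner_neq0.
  - by move=> i _; apply: prime_image; rewrite ?coordprod_neq0.
  - move=> i ik _ [x /= xh <-].
    rewrite /= -(freezeS i x).
    apply: Zfreeze; apply: freeze0 => j.
    by move: xh; rewrite meval_coordprod => /forallP.
  - move=> i ik; apply: contrapT => ni; apply: nP; exists i => // p v.
    by apply: contrapT => nv; apply: ni; exists p.
pose o := Ordinal ik.
pose h' : mpoly k F := h * (mpolyX F (mnm1 o) - 1).
have h'0 : h' != 0.
  rewrite mulf_neq0 ?coordprod_neq0 //; apply/eqP => /(congr1 (meval (fun=> 0))).
  by rewrite mevalB mevalXU meval1 meval0 sub0r => /eqP; rewrite oppr_eq0 oner_eq0.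
have [g [vg gP]] := image_contains_open Fcl Finf (ZP i.+1) h'0.
have vW p : vanish p ((f \o freeze i.+1) @` [set x | meval x h' != 0]) -> vanish p (Z i.+1).
  move=> v; have [t tP] := polymap_pullback (ZP i.+1).
  have : comp_mpoly t p * h' = 0.
    apply: mpoly_eq0_infinite => // x; rewrite mevalM tP.
    have [->|hx] := eqVneq (meval x h') 0; first by rewrite mulr0.
    by rewrite v ?mul0r //; exists x.
  move/eqP; rewrite mulf_eq0 (negbTE h'0) orbF => /eqP e _ [x _ <-].
  by rewrite -tP e meval0.
have vgi : ~ vanish g (Z i).
  move=> /iP v; apply: vg => _ [x /= hx <-]; apply: v; exists x => //=.
  by move: hx; rewrite mevalM mulf_eq0 negb_or => /andP[].
move/existsNP: vgi => [y /not_implyP[[x /= xh xy] /eqP gy]].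
have yW p : vanish p ((f \o freeze i.+1) @` [set x | meval x h' != 0]) -> meval y p = 0.
  move=> /vW v; apply: v; have -> : y = f (freeze i.+1 (freeze i x)).
    by rewrite freezeS.
  apply: Zfreeze; apply: freeze0 => j.
  by move: xh; rewrite meval_coordprod => /forallP.
have [x' /= xh' xy'] := gP y yW gy.
move: xh xh'; rewrite mevalM mulf_eq0 negb_or !meval_coordprod.
move=> /forallP x0 /andP[/forallP x0' xo'].
exists (freeze i x), (freeze i.+1 x'); split; [exact: freeze0|exact: freeze0| |by rewrite xy xy'].
move/(congr1 (fun u => u o)); rewrite /freeze /= ltnn ltnSn => xo.
by move: xo'; rewrite mevalB mevalXU meval1 -xo subrr eqxx.
Qed.

End NoInjectivePolynomialMap.

(** * Zariski topology and Krull dimension of subsets of PGL *)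

Section PGLTopology.
Variables (F : fieldType) (n : nat).

Definition mxpt (A : 'M[F]_n) : 'I_(n * n) -> F := fun k => mxvec A 0 k.

Lemma PGL_closed_sep (C : set (PGL F n)) (A : GL F n) : closed C -> ~ C (PGL_pi A) ->
  exists p : mpoly (n * n) F, meval (mxpt (GLmx A)) p != 0 /\
    forall B, C (PGL_pi B) -> meval (mxpt (GLmx B)) p = 0.
Proof.
move=> /closed_openC oC CA.
have [S SE] : zariski_open (@PGL_pi F n @^-1` (~` C)) := oC.
have : (@PGL_pi F n @^-1` (~` C)) A by [].
rewrite SE => -[p Sp pA]; exists p; split=> // B CB.
apply/eqP/negPn/negP => pB.
by have : (@PGL_pi F n @^-1` (~` C)) B by rewrite SE; exists p.
Qed.

Lemma PGL_closedP (C : set (PGL F n)) (S : set (mpoly (n * n) F)) :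
  (forall A, C (PGL_pi A) <-> forall p, S p -> meval (mxpt (GLmx A)) p = 0) -> closed C.
Proof.
move=> CP; rewrite -[C]setCK; apply: open_closedC.
suff : zariski_open (@PGL_pi F n @^-1` (~` C)) by [].
exists S; apply/seteqP; split => A /=.
  move=> CA; apply: contrapT => nS; apply: CA; apply/CP => p Sp.
  by apply: contrapT => /eqP pA; apply: nS; exists p.
by move=> [p Sp pA] /CP/(_ _ Sp)/eqP; apply/negP.
Qed.

End PGLTopology.

(** * Irreducible subsets of PGL and primality of their cones *)

Section IrreducibleSets.
Variables (F : fieldType) (n : nat).

(** The invertible part of the affine cone over [Z]; it translates questions on subsets of PGL into
    polynomials in the matrix entries. *)
Definition cone_pts (Z : set (PGL F n)) : set ('I_(n * n) -> F) :=
  [set mxpt (GLmx A) | A in @PGL_pi F n @^-1` Z].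

Lemma GL_scale_unit (c : F) (A : GL F n) : c != 0 -> c *: GLmx A \in unitmx.
Proof. by move=> c0; rewrite unitmxZ ?unitfE // GLmx_unit. Qed.

Lemma mxptZ (c : F) (A : 'M[F]_n) : mxpt (c *: A) = fun j => c * mxpt A j.
Proof. by apply/funext => j; rewrite /mxpt linearZ mxE. Qed.

Lemma polymap_scale (x : 'I_(n * n) -> F) :
  polymap (fun (c : 'I_1 -> F) j => c 0 * x j).
Proof.
move=> j; exists (mpolyX F (mnm1 0) * mpolyC 1 (x j)) => c.
by rewrite mevalM mevalC mevalXU.
Qed.

Lemma prime_cone (x : 'I_(n * n) -> F) : infinite_set [set: F] ->
  prime_set [set y | exists2 c, c != 0 & y = fun j => c * x j].
Proof.
move=> Finf; have X0 : mpolyX F (@mnm1 1 0) != 0.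
  apply/eqP => /(congr1 (meval (fun=> 1))); rewrite mevalXU meval0 => /eqP.
  by rewrite oner_eq0.
have := prime_image Finf (polymap_scale x) X0; set Y := _ @` _.
suff -> : Y = [set y | exists2 c, c != 0 & y = fun j => c * x j] by [].
apply/seteqP; split => y /=.
  by move=> [c /= c0 <-]; exists (c 0) => //; rewrite mevalXU in c0.
by move=> [c c0 ->]; exists (fun=> c) => //=; rewrite mevalXU.
Qed.

(** As [p] may be inhomogeneous, vanishing is imposed on all representatives of a class. The locus
    is cut out by the rescaled polynomials [p (c x)] with [c] nonzero, hence closed. *)
Definition cone_vanish (p : mpoly (n * n) F) : set (PGL F n) :=
  [set z | forall A, PGL_pi A = z -> meval (mxpt (GLmx A)) p = 0].

Lemma cone_vanishP p A : cone_vanish p (PGL_pi A) <->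
  forall c, c != 0 -> meval (fun j => c * mxpt (GLmx A) j) p = 0.
Proof.
split=> [v c c0|v B /PGL_pi_eq[c c0 BE]]; last by rewrite BE mxptZ v.
rewrite -mxptZ; apply: (v (MkGL (GL_scale_unit A c0))).
by apply/PGL_pi_eq; exists c.
Qed.

Lemma closed_cone_vanish p : closed (cone_vanish p).
Proof.
have sc (c : F) : polymap (fun (x : 'I_(n * n) -> F) j => c * x j).
  move=> j; exists (mpolyC _ c * mpolyX F (mnm1 j)) => x.
  by rewrite mevalM mevalC mevalXU.
apply: (@PGL_closedP _ _ _ [set q | exists2 c, c != 0 &
  forall x, meval x q = meval (fun j => c * x j) p]) => A.
rewrite cone_vanishP; split => [v q [c c0 ->]|v c c0]; first exact: v.
have [t tP] := polymap_pullback (sc c).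
by rewrite -tP; apply: v; exists c => // x; rewrite tP.
Qed.

(** The representatives of one class form a punctured line, which is prime, so [p] or [q] vanishes
    on it. Thus [Z] is covered by two closed sets and lies in one of them. *)
Lemma irreducible_prime (Z : set (PGL F n)) : infinite_set [set: F] ->
  irreducible_set Z -> prime_set (cone_pts Z).
Proof.
move=> Finf [_ Zi] p q vpq.
have sub r : Z `<=` cone_vanish r -> vanish r (cone_pts Z).
  by move=> Zr _ [A ZA <-]; exact: (Zr _ ZA).
have [|/sub|/sub] := Zi _ _ (@closed_cone_vanish p) (@closed_cone_vanish q); [|by left|by right].
move=> z; rewrite -(PGL_piK z); set A := repr z => Zz.
have [] := prime_cone (x := mxpt (GLmx A)) Finf (p := p) (q := q).
- move=> _ [c c0 ->]; rewrite -mxptZ; apply: vpq.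
  exists (MkGL (GL_scale_unit A c0)) => //=.
  suff -> : PGL_pi (MkGL (GL_scale_unit A c0)) = PGL_pi A by [].
  by apply/PGL_pi_eq; exists c.
- by move=> v; left; apply/cone_vanishP => c c0; apply: v; exists c.
- by move=> v; right; apply/cone_vanishP => c c0; apply: v; exists c.
Qed.

Lemma prime_irreducible (Z : set (PGL F n)) : Z !=set0 ->
  prime_set (cone_pts Z) -> irreducible_set Z.
Proof.
move=> Z0 Zp; split=> // B C clB clC ZBC.
have [ZB|/existsNP[x /not_implyP[Zx Bx]]] := pselect (Z `<=` B); first by left.
have [ZC|/existsNP[y /not_implyP[Zy Cy]]] := pselect (Z `<=` C); first by right.
move: Zx Bx Zy Cy; rewrite -(PGL_piK x) -(PGL_piK y) => Zx Bx Zy Cy.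
have [p [px pB]] := PGL_closed_sep clB Bx.
have [q [qy qC]] := PGL_closed_sep clC Cy.
have [|v|v] := Zp p q.
- move=> _ [A ZA <-]; rewrite mevalM.
  by case: (ZBC _ ZA) => [/pB|/qC] ->; rewrite ?mul0r ?mulr0.
- by case/eqP: px; apply: v; exists (repr x).
- by case/eqP: qy; apply: v; exists (repr y).
Qed.

End IrreducibleSets.

(** * Krull dimension of linear sections of PGL *)

Section KrullDimension.
Variables (F : fieldType) (n : nat).
Hypothesis Finf : infinite_set [set: F].
Hypothesis n0 : (0 < n)%N.

Lemma det_mx0 : \det (0 : 'M[F]_n) = 0.
Proof. by rewrite -(scale0r 1%:M) detZ expr0n eqn0Ngt n0 mul0r. Qed.

(* The chain of cones is extended below by a single point. *)
Lemma krull_chain_length (X : set (PGL F n)) k (f : ('I_k -> F) -> 'I_(n * n) -> F)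
    d (Z : nat -> set (PGL F n)) :
  polymap f -> (forall A, X (PGL_pi A) -> range f (mxpt (GLmx A))) ->
  (forall i, (i <= d)%N ->
     irreducible_set (Z i) /\ exists2 C, closed C & Z i = C `&` X) ->
  (forall i, (i < d)%N -> Z i `<` Z i.+1) -> (d < k)%N.
Proof.
move=> fP Xf Zi Zlt.
have [[[z0 Zz0] _] _] := Zi 0%N isT; move: Zz0; rewrite -(PGL_piK z0).
set A0 := repr z0 => ZA0.
pose Z' i := if i is j.+1 then cone_pts (Z j) else [set mxpt (GLmx A0)].
apply: (@chain_length F d.+1 k _ f Z').
- by [].
- move=> _ [A ZA <-]; apply: Xf; have [_ [C _ ZE]] := Zi d (leqnn d).
  by move: ZA; rewrite /= ZE => -[].
- by exists (mxpt (GLmx A0)).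
- by move=> [|i] // /andP[_ id]; apply: irreducible_prime => //; exact: (Zi i id).1.
- move=> [|i] id /=; first by move=> _ ->; exists A0.
  by move=> _ [A ZA <-]; exists A => //; exact: (Zlt i id).1.
move=> [|i] id /=; last first.
  have [_ /existsNP[z /not_implyP[]]] := Zlt i id.
  rewrite -(PGL_piK z); set A := repr z => ZA nZA.
  have [_ [C clC ZE]] := Zi i (ltnW id).
  have [_ [C' _ ZE']] := Zi i.+1 id.
  have nCA : ~ C (PGL_pi A).
    by move=> CA; apply: nZA; rewrite ZE; split=> //; move: ZA; rewrite ZE' => -[].
  have [p [pA pC]] := PGL_closed_sep clC nCA.
  exists p; split.
    by move=> _ [B ZB <-]; apply: pC; move: ZB; rewrite /= ZE => -[].
  by move=> v; case/eqP: pA; apply: v; exists A.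
(* At the bottom of the chain, a nonzero coordinate of [A0] changes under scaling by some [c] other
   than 0 and 1, so it separates the single point from the cone over [Z 0]. *)
have [j Aj] : exists j, mxpt (GLmx A0) j != 0.
  apply: contrapT => /forallNP A00; have : GLmx A0 = 0.
    apply: (can_inj mxvecK); apply/rowP => j; rewrite linear0 mxE.
    by have /negP/negPn/eqP := A00 j.
  by have := GLmx_unit A0 => /[swap] ->; rewrite unitmxE det_mx0 unitr0.
have [c] := infinite_notin [:: 0; 1] Finf; rewrite !inE negb_or => /andP[c0 c1].
exists (mpolyX F (mnm1 j) - mpolyC _ (mxpt (GLmx A0) j)); split.
  by move=> _ ->; rewrite mevalB mevalXU mevalC subrr.
move=> v; have : cone_pts (Z 0%N) (mxpt (c *: GLmx A0)).
  exists (MkGL (GL_scale_unit A0 c0)) => //=.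
  suff -> : PGL_pi (MkGL (GL_scale_unit A0 c0)) = PGL_pi A0 by [].
  by apply/PGL_pi_eq; exists c.
move=> /v/eqP; rewrite mevalB mevalXU mevalC mxptZ subr_eq0.
by rewrite -{2}[mxpt _ _]mul1r (inj_eq (mulIf Aj)) (negbTE c1).
Qed.

(** A linear section of PGL; the whole group and the split maximal tori have this form. *)
Definition subspace_image m (V : 'M[F]_(m, n * n)) : set (PGL F n) :=
  [set PGL_pi A | A in [set A : GL F n | (mxvec (GLmx A) <= V)%MS]].

Lemma subspace_imageE m (V : 'M[F]_(m, n * n)) (A : GL F n) :
  subspace_image V (PGL_pi A) <-> (mxvec (GLmx A) <= V)%MS.
Proof.
split; last by exists A.
by move=> [B /= BV] /esym/PGL_pi_eq[c c0 ->]; rewrite linearZ /= scalemx_sub.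
Qed.

Lemma closed_subspace_image m (V : 'M[F]_(m, n * n)) : closed (subspace_image V).
Proof.
pose l j := \sum_k mpolyX F (mnm1 k) * mpolyC (n * n) (cokermx V k j).
have lE A j : meval (mxpt (GLmx A)) (l j) = (mxvec (GLmx A) *m cokermx V) 0 j.
  rewrite raddf_sum mxE; apply: eq_bigr => k _ /=.
  by rewrite mevalM mevalXU mevalC.
apply: (@PGL_closedP _ _ _ (range l)) => A.
rewrite subspace_imageE submxE; split => [/eqP A0 _ [j _ <-]|A0].
  by rewrite lE A0 mxE.
by apply/eqP/rowP => j; rewrite -lE A0 ?mxE.
Qed.

Definition mxpoly_var : 'M[mpoly (n * n) F]_n :=
  \matrix_(i, j) mpolyX F (mnm1 (mxvec_index i j)).

Lemma meval_det (A : 'M[F]_n) : meval (mxpt A) (\det mxpoly_var) = \det A.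
Proof.
rewrite -det_map_mx; congr (\det _).
by apply/matrixP => i j; rewrite !mxE /= mevalXU /mxpt mxvecE.
Qed.

Lemma polymap_mulmx k (W : 'M[F]_(k, n * n)) :
  polymap (fun x j => ((\row_i x i) *m W) 0 j).
Proof.
move=> j; exists (\sum_i mpolyX F (mnm1 i) * mpolyC k (W i j)) => x.
rewrite mxE raddf_sum; apply: eq_bigr => i _.
by rewrite mxE /= mevalM mevalXU mevalC.
Qed.

(** The cone is the image of the locus of nonzero determinant under the linear parametrization by
    the rows of [W]; the identity matrix shows that this locus is nonempty. *)
Lemma irreducible_subspace_image k (W : 'M[F]_(k, n * n)) :
  (mxvec 1%:M <= W)%MS -> irreducible_set (subspace_image W).
Proof.
move=> W1; apply: prime_irreducible.
  by exists (PGL_pi 1%g), 1%g.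
have [t tP] := polymap_pullback (polymap_mulmx W).
have tD x : meval x (comp_mpoly t (\det mxpoly_var)) = \det (vec_mx ((\row_i x i) *m W)).
  rewrite tP -meval_det; apply: meval_eq => j.
  by rewrite /mxpt vec_mxK.
have [u uE] := submxP W1.
have D0 : comp_mpoly t (\det mxpoly_var) != 0.
  apply/eqP => /(congr1 (meval (fun i => u 0 i))); rewrite tD meval0.
  rewrite (_ : \row_i _ = u); last by apply/rowP => i; rewrite mxE.
  by rewrite -uE mxvecK det1 => /eqP; rewrite oner_eq0.
have := prime_image Finf (polymap_mulmx W) D0; set Y := _ @` _.
suff -> : Y = cone_pts (subspace_image W) by [].
apply/seteqP; split => y /=.
  move=> [x /= Dx <-]; rewrite tD -unitfE -unitmxE in Dx.
  exists (MkGL Dx) => /=; first by apply/subspace_imageE; rewrite /= vec_mxK submxMl.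
  by apply/funext => j; rewrite /mxpt vec_mxK.
move=> [A /= /subspace_imageE/submxP[v vE] <-]; exists (fun i => v 0 i) => /=.
  rewrite tD (_ : \row_i _ = v); last by apply/rowP => i; rewrite mxE.
  by rewrite -vE mxvecK -unitfE -unitmxE GLmx_unit.
rewrite (_ : \row_i _ = v); last by apply/rowP => i; rewrite mxE.
by apply/funext => j; rewrite -vE.
Qed.

(* If B lies in W but not in V then so does 1 + c B for c nonzero, and this is
   invertible for some c because its determinant is 1 at c = 0. *)
Lemma subspace_image_lt m1 m2 (V : 'M[F]_(m1, n * n)) (W : 'M[F]_(m2, n * n)) :
  (mxvec 1%:M <= V)%MS -> (V <= W)%MS -> ~~ (W <= V)%MS ->
  subspace_image V `<` subspace_image W.
Proof.
move=> V1 VW /row_subPn[r rV]; split.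
  by move=> _ [A /= AV <-]; apply/subspace_imageE; exact: submx_trans VW.
set B := vec_mx (row r W).
have fP : polymap (fun (c : 'I_1 -> F) j => mxpt (1%:M + c 0 *: B) j).
  move=> j; exists (mpolyC 1 (mxpt 1%:M j) + mpolyX F (mnm1 0) * mpolyC 1 (mxpt B j)) => c.
  by rewrite mevalD mevalM !mevalC mevalXU /mxpt linearD linearZ !mxE.
have [t tP] := polymap_pullback fP.
set q := comp_mpoly t (\det mxpoly_var) * mpolyX F (mnm1 0).
have [x qx] : exists x, meval x q != 0.
  apply: contrapT => /forallNP q0; have : q = 0.
    by apply: mpoly_eq0_infinite => // x; have /negP/negPn/eqP := q0 x.
  move/eqP; rewrite mulf_eq0 => /orP[]/eqP.
    move/(congr1 (meval (fun=> 0))); rewrite tP meval_det scale0r addr0 det1 meval0.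
    by move/eqP; rewrite oner_eq0.
  by move/(congr1 (meval (fun=> 1))); rewrite mevalXU meval0 => /eqP; rewrite oner_eq0.
move: qx; rewrite mevalM mulf_eq0 negb_or tP meval_det mevalXU => /andP[Dx x0].
rewrite -unitfE -unitmxE in Dx.
move=> /(_ (PGL_pi (MkGL Dx))) /=; rewrite !subspace_imageE /= linearD linearZ /= vec_mxK.
have WW : ((mxvec 1%:M + x 0 *: row r W)%R <= W)%MS.
  by rewrite addmx_sub ?scalemx_sub ?row_sub // (submx_trans V1).
move=> /(_ WW) WV; case/negP: rV.
have -> : row r W = (x 0)^-1 *: (- mxvec 1%:M + (mxvec 1%:M + x 0 *: row r W)).
  by rewrite addKr scalerA mulVf ?scale1r.
by rewrite scalemx_sub // addmx_sub // eqmx_opp.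
Qed.

(** [u] is completed to a basis of [V], and [W i] is the span of its first [i + 1] members. When [u]
    is the identity matrix, every term of the flag gives an irreducible set. *)
Lemma subspace_flag m (V : 'M[F]_(m, n * n)) (u : 'rV[F]_(n * n)) :
  u != 0 -> (u <= V)%MS -> exists W : nat -> 'M[F]_(n * n),
  [/\ forall i, (i < \rank V)%N -> \rank (W i) = i.+1,
      forall i, (u <= W i)%MS, forall i, (W i <= W i.+1)%MS
    & (W (\rank V).-1 :=: V)%MS].
Proof.
move=> u0 uV; set C := (V :\: u)%MS; pose B := col_mx u (row_base C).
have uE : (V :&: u :=: u)%MS by apply/capmx_idPr.
have BE : (B :=: V)%MS.
  apply: eqmx_trans (eqmx_sym (addsmxE _ _)) _.
  apply: eqmx_trans (addsmx_diff_cap_eq V u).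
  rewrite addsmxC; apply: adds_eqmx (eqmx_sym uE); exact: eq_row_base.
have Vr : \rank V = (1 + \rank C)%N.
  by have := mxrank_cap_compl V u; rewrite uE rank_rV u0 => ->.
pose W i : 'M[F]_(n * n) := <<(pid_mx i.+1 : 'M[F]_(1 + \rank C)) *m B>>%MS.
have Bf : row_free B by rewrite /row_free BE Vr.
exists W; split.
- move=> i iV; by rewrite mxrank_gen mxrankMfree // rank_pid_mx // -Vr.
- move=> i; rewrite genmxE.
  have -> : u = (pid_mx 1 : 'M[F]_(1, 1 + \rank C)) *m B.
    by rewrite pid_mx_row mul_row_col mul1mx mul0mx addr0.
  have -> : pid_mx 1 = (pid_mx 1 : 'M[F]_(1, 1 + \rank C)) *m (pid_mx i.+1 : 'M[F]_(1 + \rank C)).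
    by rewrite mul_pid_mx; congr pid_mx; lia.
  by rewrite -mulmxA submxMl.
- move=> i; rewrite !genmxE.
  have -> : pid_mx i.+1 = (pid_mx i.+1 : 'M[F]_(1 + \rank C)) *m (pid_mx i.+2 : 'M[F]_(1 + \rank C)).
    rewrite mul_pid_mx -[LHS]pid_mx_minv; congr pid_mx; lia.
  by rewrite -mulmxA submxMl.
rewrite Vr /=; apply: eqmx_trans (genmxE _) _.
by rewrite pid_mx_1 mul1mx.
Qed.

(** The upper bound comes from a parametrization by [\rank V] coordinates, the lower bound from a
    flag through the identity. Scalars account for the loss of one dimension. *)
Lemma krull_dim_subspace_image m (V : 'M[F]_(m, n * n)) :
  (mxvec 1%:M <= V)%MS -> krull_dim (subspace_image V) = ((\rank V).-1)%:R%:E.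
Proof.
move=> V1; have u0 : mxvec (1%:M : 'M[F]_n) != 0.
  rewrite -(linear0 (mxvec : 'M[F]_n -> _)) (can_eq mxvecK); apply/eqP => /(congr1 determinant).
  by rewrite det1 det_mx0 => /eqP; rewrite oner_eq0.
have Vgt0 : (0 < \rank V)%N by rewrite (leq_trans _ (mxrankS V1)) // rank_rV u0.
apply/eqP; rewrite eq_le; apply/andP; split.
  apply: ge_ereal_sup => _ [d [Z [Zi Zlt]] <-]; rewrite lee_fin ler_nat.
  rewrite -ltnS prednK //.
  apply: (krull_chain_length (polymap_mulmx (row_base V))) Zi Zlt.
  move=> A /subspace_imageE; rewrite -(eq_row_base V) => /submxP[v vE].
  exists (fun i => v 0 i) => //; apply/funext => j; rewrite /mxpt vE.
  by congr ((_ *m _) _ _); apply/rowP => i; rewrite mxE.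
have [W [Wr W1 WS WV]] := subspace_flag u0 V1.
apply: ereal_sup_ubound; exists (\rank V).-1 => //.
exists (fun i => subspace_image (W i)); split.
  move=> i iV; split; first exact: irreducible_subspace_image.
  exists (subspace_image (W i)); first exact: closed_subspace_image.
  have WiV : (W i <= V)%MS.
    rewrite -WV; elim: (_.-1) {Wr WV} iV => [|j IHj]; first by rewrite leqn0 => /eqP ->.
    by rewrite leq_eqVlt => /predU1P[->|/IHj/submx_trans->].
  apply/seteqP; split => z; last by case.
  move=> Wz; split => //; move: Wz; rewrite -(PGL_piK z) !subspace_imageE.
  by move/submx_trans; apply.
move=> i iV; apply: subspace_image_lt => //.
have i1V : (i.+1 < \rank V)%N by rewrite -[X in (_ < X)%N]prednK // ltnS.
by apply/negP => /mxrankS; rewrite !Wr // ?ltnn // ltnW.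
Qed.

End KrullDimension.

(** * Projective frames and their tori *)

Section Frames.
Variables (F : fieldType) (n : nat).
Implicit Types (P R : 'M[F]_(n.+1, n)) (z : PGL F n) (A B : GL F n).

Lemma PGL_piM A B : (PGL_pi A * PGL_pi B)%g = PGL_pi (A * B)%g.
Proof. exact: PGL_pi_mul. Qed.

Lemma PGL_piV A : ((PGL_pi A)^-1)%g = PGL_pi (A^-1)%g.
Proof. exact: PGL_pi_inv. Qed.

Lemma PGL_piJ A B : conjg (PGL_pi A) (PGL_pi B) = PGL_pi (B^-1 * (A * B))%g.
Proof. by rewrite conjgE PGL_piV [(PGL_pi A * _)%g]PGL_piM PGL_piM. Qed.

Lemma PGL_pi1 : PGL_pi (1 : GL F n)%g = 1%g.
Proof. by []. Qed.

Definition frame P : Prop := forall i, (row' i P : 'M[F]_n) \in unitmx.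

Lemma mul_frame P (u : 'rV[F]_n.+1) i :
  u *m P = u 0 i *: row i P + (col' i u : 'rV[F]_n) *m (row' i P : 'M[F]_n).
Proof.
apply/rowP => j; rewrite !mxE (bigD1_ord i) //=; congr (_ + _).
by apply: eq_bigr => k _; rewrite !mxE.
Qed.

Lemma frame_ker P (u : 'rV[F]_n.+1) i : frame P -> u *m P = 0 -> u 0 i = 0 -> u = 0.
Proof.
move=> fP uP ui; move: uP; rewrite (mul_frame _ _ i) ui scale0r add0r => uP.
have {}uP : (col' i u : 'rV[F]_n) = 0 by rewrite -[LHS](mulmxK (fP i)) uP mul0mx.
apply/rowP => j; rewrite mxE; case: (unliftP i j) => [k ->|->//].
by have /rowP/(_ k) := uP; rewrite !mxE.
Qed.

Lemma unitmx_ker m (M : 'M[F]_m) : (forall v : 'rV_m, v *m M = 0 -> v = 0) -> M \in unitmx.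
Proof.
move=> Mv; rewrite -row_free_unit -kermx_eq0; apply/eqP/row_matrixP => i.
by rewrite row0; apply: Mv; apply/sub_kermxP; exact: row_sub.
Qed.

Lemma ker_frame P : (forall i (u : 'rV[F]_n.+1), u *m P = 0 -> u 0 i = 0 -> u = 0) -> frame P.
Proof.
move=> Pu i; apply: unitmx_ker => v vP.
pose u : 'rV[F]_n.+1 := \row_j (if unlift i j is Some k then v 0 k else 0).
have cu : (col' i u : 'rV[F]_n) = v by apply/rowP => k; rewrite !mxE liftK.
have ui : u 0 i = 0 by rewrite mxE unlift_none.
have u0 : u = 0 by apply: (Pu i) => //; rewrite (mul_frame _ _ i) ui scale0r add0r cu.
by rewrite -cu u0; apply/rowP => k; rewrite !mxE.
Qed.

(** [n + 1] vectors of an [n]-dimensional space are dependent, and a relation omitting one of them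
    is trivial because the others form a basis. *)
Lemma frame_relation P : frame P ->
  exists2 u : 'rV[F]_n.+1, u *m P = 0 & forall j, u 0 j != 0.
Proof.
move=> fP; have /rowV0Pn[u uP u0] : kermx P != 0.
  by rewrite kermx_eq0 /row_free neq_ltn ltnS rank_leq_col.
have {}uP : u *m P = 0 by apply/sub_kermxP.
exists u => // j; apply: contraNneq u0 => uj; apply/eqP; exact: frame_ker uP uj.
Qed.

Definition fixes_line P j z : Prop :=
  exists l, row j P *m GLmx (repr z) = l *: row j P.

Lemma fixes_lineP P j A :
  fixes_line P j (PGL_pi A) <-> exists l, row j P *m GLmx A = l *: row j P.
Proof.
have /PGL_pi_eq[c c0 AE] := PGL_piK (PGL_pi A).
rewrite /fixes_line AE; split=> [[l]|[l lE]]; last first.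
  by exists (c * l); rewrite -scalemxAr lE scalerA.
rewrite -scalemxAr => /(congr1 ( *:%R c^-1)); rewrite !scalerA mulVf // scale1r => ->.
by exists (c^-1 * l).
Qed.

Lemma fixes_line1 P j : fixes_line P j 1%g.
Proof. by apply/fixes_lineP; exists 1; rewrite mulmx1 scale1r. Qed.

Lemma fixes_lineM P j z z' :
  fixes_line P j z -> fixes_line P j z' -> fixes_line P j (z * z')%g.
Proof.
rewrite -(PGL_piK z) -(PGL_piK z') PGL_piM => /fixes_lineP[l lE] /fixes_lineP[l' lE'].
by apply/fixes_lineP; exists (l * l'); rewrite /= mulmxA lE -scalemxAl lE' scalerA.
Qed.

Lemma fixes_lineV P j z : fixes_line P j z -> fixes_line P j (z^-1)%g.
Proof.
rewrite -(PGL_piK z) PGL_piV => /fixes_lineP[l lE]; apply/fixes_lineP => /=.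
set A := repr z in lE *; exists l^-1.
have E : l *: (row j P *m invmx (GLmx A)) = row j P.
  by rewrite scalemxAl -lE mulmxK // GLmx_unit.
have [l0|l0] := eqVneq l 0; last by rewrite -{2}E scalerA mulVf // scale1r.
by rewrite -E l0 scale0r mul0mx scaler0.
Qed.

(** With eigenvalues [l j], both [u j] and [u j * l j] are relations between the rows. Their
    combination [v] has a zero entry, hence vanishes; so all eigenvalues agree and [A] is scalar. *)
Lemma frame_fix1 P z : frame P -> (forall j, fixes_line P j z) -> z = 1%g.
Proof.
rewrite -(PGL_piK z); set A := repr z => fP fA.
have [l lE] := choice (fun j => (fixes_lineP P j A).1 (fA j)).
have [u uP u0] := frame_relation fP.
have l0 j : l j = l 0.
  pose v : 'rV[F]_n.+1 := \row_j (u 0 j * (l j - l 0)).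
  have vP : v *m P = 0.
    have e : (\row_j (u 0 j * l j)) *m P = u *m P *m GLmx A.
      rewrite -mulmxA (mulmx_sum_row u) mulmx_sum_row; apply: eq_bigr => k _.
      by rewrite mxE row_mul lE scalerA.
    rewrite (_ : v = \row_j (u 0 j * l j) - l 0 *: u).
      by rewrite mulmxBl e -scalemxAl uP mul0mx scaler0 subrr.
    by apply/rowP => k; rewrite !mxE mulrBr [l 0 * _]mulrC.
  have v0 : v 0 0 = 0 by rewrite mxE subrr mulr0.
  have /rowP/(_ j) := frame_ker fP vP v0; rewrite !mxE => /eqP.
  by rewrite mulf_eq0 (negbTE (u0 j)) subr_eq0 => /eqP.
have AE : GLmx A = (l 0)%:M.
  rewrite -[LHS](mulKmx (fP 0)) -[RHS](mulKmx (fP 0)); congr (_ *m _).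
  apply/row_matrixP => k; rewrite row_mul [RHS]row_mul row_rowsub.
  by rewrite mul_mx_scalar lE l0.
(* A zero eigenvalue contradicts invertibility unless [n = 0], where all matrices are equal. *)
rewrite -PGL_pi1; have [l00|l00] := eqVneq (l 0) 0.
  apply/PGL_pi_eq; exists 1; rewrite ?oner_neq0 //= scale1r AE l00.
  have := GLmx_unit A; rewrite AE l00 unitmxE det_scalar expr0n.
  case: (posnP n) => [n0 _|n0]; last by rewrite unitr0.
  by apply/matrixP => i; suff: false by []; rewrite -(ltn0 i) -[X in (_ < X)%N]n0 ltn_ord.
by apply/PGL_pi_eq; exists (l 0) => //; rewrite AE scalemx1.
Qed.

Definition frame_basis P (fP : frame P) i : GL F n := MkGL (fP i).

Definition frame_torus P (fP : frame P) i : set (PGL F n) :=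
  [set conjg t (PGL_pi (frame_basis fP i)) | t in @diag_torus F n].

Lemma split_frame_torus P (fP : frame P) i : split_maximal_torus (frame_torus fP i).
Proof. by eexists. Qed.

(** In the basis of the rows other than the [i]-th, fixing their lines means being diagonal. *)
Lemma frame_torusP P (fP : frame P) i z :
  frame_torus fP i z <-> forall j, j != i -> fixes_line P j z.
Proof.
rewrite -(PGL_piK z); set A := repr z; split.
  move=> [_ [D /= Dd <-]]; rewrite PGL_piJ => /PGL_pi_eq[c c0 /= AE] j.
  case: (unliftP i j) => [k ->|->]; last by rewrite eqxx.
  move=> _; apply/fixes_lineP; exists (c^-1 * GLmx D k k).
  rewrite -[LHS]scale1r -(mulVf c0) -scalerA [in LHS]scalemxAr -AE -scalerA; congr (_ *: _).
  have -> : row (lift i k) P = row k (row' i P) by rewrite row_rowsub.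
  rewrite -row_mul !mulmxA mulmxV // mul1mx row_mul.
  have /is_diag_mxP Dd' := Dd.
  apply/rowP => a; rewrite !mxE (bigD1 k) //= big1 ?addr0 ?mxE // => b bk.
  by rewrite mxE Dd' ?mul0r // eq_sym.
move=> fA; have fl k : fixes_line P (lift i k) (PGL_pi A) by apply: fA; rewrite eq_sym neq_lift.
have [l lE] := choice (fun k => (fixes_lineP P _ A).1 (fl k)).
set B := frame_basis fP i.
have BA : GLmx (B * A)%g = diag_mx (\row_k l k) *m GLmx B.
  apply/row_matrixP => k; rewrite row_mul row_rowsub lE mul_diag_mx.
  by apply/rowP => a; rewrite !mxE.
exists (PGL_pi (B * A * B^-1)%g).
  exists (B * A * B^-1)%g => //=; move: BA => /= ->.
  by rewrite mulmxK ?fP // diag_mx_is_diag.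
by rewrite PGL_piJ -!mulgA mulVg mulg1 !mulgA mulVg mul1g.
Qed.

End Frames.

(** * Packing by frame tori and factorization through mixed frames *)

Section FramePackingCovering.
Variables (F : fieldType) (n : nat).
Implicit Types (P R : 'M[F]_(n.+1, n)).

(* t_r s_r^-1 fixes the lines of the frame with index different from r because
   t_r and s_r do, and the r-th line because it is also the quotient of the
   products of the preceding factors; hence it is 1. *)
Lemma frame_packing P (fP : frame P) : toric_packing (frame_torus fP).
Proof.
split=> [i|]; first exact: split_frame_torus.
suff H r (rn : (r <= n.+1)%N) (t s : 'I_n.+1 -> PGL F n) :
    (forall i, frame_torus fP i (t i)) -> (forall i, frame_torus fP i (s i)) ->
    (\prod_(i < r) t (widen_ord rn i) = \prod_(i < r) s (widen_ord rn i))%g ->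
    forall i : 'I_r, t (widen_ord rn i) = s (widen_ord rn i).
  move=> t s /set_mem tT /set_mem sT ts; apply/ffunP => i.
  have w j : widen_ord (leqnn n.+1) j = j by exact: val_inj.
  rewrite -(w i); apply: H => //; rewrite /mul_map in ts.
  by under eq_bigr do rewrite w; rewrite ts; apply: eq_bigr => j _; rewrite w.
move=> tT sT; elim: r rn => [|r IHr] rn; first by move=> _ [].
rewrite !big_ord_recr /=; set a := (\prod_(i < r) _)%g; set b := (\prod_(i < r) _)%g.
set k := widen_ord rn ord_max => ab.
have fix_prod (u : 'I_n.+1 -> PGL F n) : (forall i, frame_torus fP i (u i)) ->
    fixes_line P k (\prod_(i < r) u (widen_ord rn (widen_ord (leqnSn r) i)))%g.
  move=> uT; apply: (big_ind (fixes_line P k)).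
  - exact: fixes_line1.
  - exact: fixes_lineM.
  move=> i _; apply: (frame_torusP _ _ _).1 (uT _) _ _.
  by rewrite -val_eqE /= neq_ltn ltn_ord orbT.
have tsk : t k = s k.
  apply/eqP; rewrite -divg_eq1; apply/eqP; apply: (frame_fix1 fP) => j.
  have [->|jk] := eqVneq j k; last first.
    by apply: fixes_lineM; last apply: fixes_lineV; move: j jk; apply/frame_torusP.
  have -> : (t k * (s k)^-1 = a^-1 * b)%g.
    by rewrite -(mulKg a (t k)) ab -!mulgA mulgV mulg1.
  by apply: fixes_lineM; first apply: fixes_lineV; apply: fix_prod.
have {}ab : (a = b)%g by apply: (mulIg (t k)); rewrite ab tsk.
move=> i; case: (unliftP ord_max i) => [j ->|-> //].
have e : widen_ord rn (lift ord_max j) = widen_ord (ltnW rn) j.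
  by apply: val_inj; rewrite /= /bump leqNgt ltn_ord.
rewrite e; apply: IHr; transitivity a; last rewrite ab.
  by apply: eq_bigr => i' _; congr t; exact: val_inj.
by apply: eq_bigr => i' _; congr s; exact: val_inj.
Qed.

(** [G] is prescribed on [n] of the rows. The factors [w j / u j] make it carry the relation [u] of
    [P] to the relation [w] of [R], which forces the correct image of the remaining row. *)
Lemma frame_transfer P R : frame P -> frame R ->
  exists (G : GL F n) (m : 'I_n.+1 -> F),
    forall j, m j != 0 /\ row j P *m GLmx G = m j *: row j R.
Proof.
move=> fP fR; have [u uP u0] := frame_relation fP.
have [w wR w0] := frame_relation fR.
pose m j := w 0 j / u 0 j.
have m0 j : m j != 0 by rewrite mulf_neq0 ?invr_neq0.
pose D := diag_mx (\row_k m (lift 0 k)) : 'M[F]_n.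
have GU : invmx (row' 0 P : 'M[F]_n) *m D *m (row' 0 R : 'M[F]_n) \in unitmx.
  rewrite !unitmx_mul unitmx_inv fP fR andbT /= unitmxE det_diag unitfE.
  by apply/prodf_neq0 => k _; rewrite mxE.
pose G := MkGL GU.
have GE : (row' 0 P : 'M[F]_n) *m GLmx G = D *m (row' 0 R : 'M[F]_n).
  by rewrite /= !mulmxA mulmxV // mul1mx.
have Gl k : row (lift 0 k) P *m GLmx G = m (lift 0 k) *: row (lift 0 k) R.
  have -> : row (lift 0 k) P = row k (row' 0 P) by rewrite row_rowsub.
  rewrite -row_mul GE mul_diag_mx; apply/rowP => a; by rewrite !mxE.
exists G, m => j; split => //; case: (unliftP 0 j) => [k ->|->]; first exact: Gl.
apply: (scalerI (u0 0)); rewrite scalerA mulrCA divff // mulr1 scalemxAl.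
have -> : u 0 0 *: row 0 P = - ((col' 0 u : 'rV[F]_n) *m (row' 0 P : 'M[F]_n)).
  by apply/eqP; rewrite -addr_eq0 -mul_frame uP.
have -> : w 0 0 *: row 0 R = - ((col' 0 w : 'rV[F]_n) *m (row' 0 R : 'M[F]_n)).
  by apply/eqP; rewrite -addr_eq0 -mul_frame wR.
rewrite mulNmx -mulmxA GE mulmxA; congr (- (_ *m _)).
apply/rowP => k; rewrite mul_mx_diag !mxE mulrC divfK //.
Qed.

Definition mixed_frame P R (i : nat) : 'M[F]_(n.+1, n) :=
  \matrix_(j, a) if (j < i)%N then P j a else R j a.

(* With G_i carrying the lines of P to those of the i-th mixed configuration,
   G_i G_(i+1)^-1 lies in the i-th torus and the product telescopes. *)
Lemma frame_factorization P (fP : frame P) (g : GL F n) :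
  (forall i, (i <= n.+1)%N -> frame (mixed_frame P (P *m GLmx g) i)) ->
  exists t : 'I_n.+1 -> PGL F n,
    (forall i, frame_torus fP i (t i)) /\ PGL_pi g = (\prod_i t i)%g.
Proof.
move=> fM; set M := mixed_frame P (P *m GLmx g) in fM.
have /choice[G GP] : forall i, exists G : GL F n, (i <= n.+1)%N ->
    forall j, exists2 m, m != 0 & row j P *m GLmx G = m *: row j (M i).
  move=> i; have [iN|_] := leqP i n.+1; last by exists 1%g.
  have [G [m mP]] := frame_transfer fP (fM i iN).
  by exists G => _ j; exists (m j); case: (mP j).
have MP i (j : 'I_n.+1) : (j < i)%N -> row j (M i) = row j P.
  by move=> ji; apply/rowP => a; rewrite !mxE ji.
have MQ i (j : 'I_n.+1) : (i <= j)%N -> row j (M i) = row j P *m GLmx g.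
  by move=> ij; apply/rowP => a; rewrite -row_mul !mxE ltnNge ij.
have ratio i i' j (A B : GL F n) c d (r : 'rV[F]_n) : c != 0 -> d != 0 ->
    row j P *m GLmx A = c *: r -> row j P *m GLmx B = d *: r ->
    i = i' :> nat -> fixes_line P j (PGL_pi A * (PGL_pi B)^-1)%g.
  move=> c0 d0 AE BE _; rewrite PGL_piV PGL_piM; apply/fixes_lineP.
  exists (c / d); rewrite /= mulmxA AE -[r]scale1r -(mulVf d0) -[in LHS]scalerA -BE.
  by rewrite !scalerA -scalemxAl mulmxK ?GLmx_unit.
exists (fun i => PGL_pi (G i) * (PGL_pi (G i.+1))^-1)%g; split=> [i|].
  apply/frame_torusP => j ji.
  have [m m0 mE] := GP i (ltnW (ltn_ord i)) j.
  have [m' m'0 mE'] := GP i.+1 (ltn_ord i) j.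
  apply: (ratio i i j _ _ _ _ _ m0 m'0 mE) => //; rewrite mE'; congr (_ *: _).
  have [lji|lij] := ltnP j i; first by rewrite !MP // ltnW.
  by rewrite !MQ // ltn_neqAle eq_sym ji.
have -> : (\prod_(i < n.+1) (PGL_pi (G i) * (PGL_pi (G i.+1))^-1) =
           PGL_pi (G 0%N) * (PGL_pi (G n.+1))^-1)%g.
  elim: n.+1 => [|r IHr]; first by rewrite big_ord0 mulgV.
  by rewrite big_ord_recr /= IHr !mulgA mulgVK.
(* The configuration of index [n + 1] is [P], so the last transfer is trivial; that of index 0 is
   [P g], so the first one is [g]. *)
have -> : PGL_pi (G n.+1) = 1%g.
  apply: (frame_fix1 fP) => j; apply/fixes_lineP.
  by have [m _ ->] := GP n.+1 (leqnn _) j; exists m; rewrite MP.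
rewrite invg1 mulg1; apply/esym/eqP; rewrite -divg_eq1; apply/eqP; apply: (frame_fix1 fP) => j.
have [m m0 mE] := GP 0%N isT j; rewrite MQ // in mE.
by apply: (ratio 0%N 0%N j _ _ _ _ _ m0 (oner_neq0 _) mE) => //; rewrite scale1r.
Qed.

End FramePackingCovering.

(** * Generic position *)

Section GenericFrame.
Variable F : fieldType.

(* The determinant is affine in each coordinate of x. Starting from the
   nonzero pure determinants, the coordinates are introduced one at a time;
   each of the determinants forbids at most one value of the new coordinate. *)
Lemma multiaffine_nonvanishing (n : nat) (J : finType) (A B : J -> 'M[F]_n) (s : seq F) :
  uniq s -> (#|J| < size s)%N ->
  (forall j, exists S : {set 'I_n},
     \det (\matrix_(a, b) (if a \in S then A j a b else B j a b)) != 0) ->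
  exists x : 'I_n -> F, forall j, \det (\matrix_(a, b) (x a * A j a b + B j a b)) != 0.
Proof.
move=> us Js /choice[S SP].
(* Pairs of weights treat the pure choices [(1, 0)] and [(0, 1)] and the affine choice [(x, 1)]
   alike, so that one can replace the other row by row. *)
pose M (r : 'I_n -> F * F) j : 'M[F]_n :=
  \matrix_(a, b) ((r a).1 * A j a b + (r a).2 * B j a b).
pose r0 j a : F * F := if a \in S j then (1, 0) else (0, 1).
pose upd (r : 'I_n -> F * F) k c a := if a == k then c else r a.
have Mdet r j k c : \det (M (upd r k c) j) =
    c.1 * \det (M (upd r k (1, 0)) j) + c.2 * \det (M (upd r k (0, 1)) j).
  apply: (determinant_multilinear (i0 := k)).
  - by apply/rowP => b; rewrite !mxE /upd eqxx /= mul1r !mul0r mul1r addr0 add0r.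
  - by apply/matrixP => a b; rewrite !mxE /upd eq_sym (negbTE (neq_lift _ _)).
  - by apply/matrixP => a b; rewrite !mxE /upd eq_sym (negbTE (neq_lift _ _)).
pose r k (x : 'I_n -> F) j (a : 'I_n) : F * F := if (a < k)%N then (x a, 1) else r0 j a.
suff H k : (k <= n)%N -> exists x : 'I_n -> F, forall j, \det (M (r k x j) j) != 0.
  have [x xP] := H n (leqnn n).
  exists x => j; have := xP j; congr (\det _ != 0).
  by apply/matrixP => a b; rewrite !mxE /r ltn_ord mul1r.
elim: k => [|k IHk] kn.
  exists (fun=> 0) => j; have := SP j; congr (\det _ != 0).
  apply/matrixP => a b; rewrite !mxE /r /r0.
  by case: ifP => _ /=; rewrite mul1r mul0r ?addr0 ?add0r.
have [x xP] := IHk (ltnW kn); pose o := Ordinal kn.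
pose al j := \det (M (upd (r k x j) o (1, 0)) j).
pose be j := \det (M (upd (r k x j) o (0, 1)) j).
have albe j : (al j != 0) || (be j != 0).
  apply: contraNT (xP j); rewrite negb_or !negbK => /andP[/eqP al0 /eqP be0].
  have -> : r k x j = upd (r k x j) o (r k x j o).
    by apply/funext => a; rewrite /upd; case: eqP => [->|].
  by rewrite Mdet -/(al j) -/(be j) al0 be0 !mulr0 addr0.
have [c cs cP] : exists2 c, c \in s & forall j, c != - be j / al j.
  apply: contrapT => nc; have /(uniq_leq_size us) : {subset s <= [seq - be j / al j | j : J]}.
    move=> c cs; apply: contrapT => /negP cn; apply: nc; exists c => // j.
    by apply: contraNneq cn => ->; apply/mapP; exists j; rewrite ?mem_enum.
  by rewrite size_map -cardE leqNgt Js.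
exists (fun a => if a == o then c else x a) => j.
have -> : r k.+1 (fun a => if a == o then c else x a) j = upd (r k x j) o (c, 1).
  apply/funext => a; rewrite /r /upd ltnS leq_eqVlt -(inj_eq val_inj) /=.
  by case: eqP => //= ->.
rewrite Mdet -/(al j) -/(be j) /= mul1r.
have [al0|al0] := eqVneq (al j) 0.
  by have := albe j; rewrite al0 eqxx mulr0 add0r.
apply: contraNneq (cP j) => e; rewrite -[c](mulfK al0).
by move/eqP: e; rewrite addr_eq0 => /eqP ->.
Qed.

Variable n : nat.

Section Cauchy.
Variables (al : 'I_n -> F) (be : 'I_n.+1 -> F).
Hypotheses (al_inj : injective al) (be_inj : injective be).
Hypothesis al_be : forall a c, al a != be c.

Definition cauchy_mx : 'M[F]_(n.+1, n) := \matrix_(c, a) (al a - be c)^-1.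

(* Clearing denominators turns the relation into a polynomial of degree less
   than #|C| that vanishes at the #|S| points al a. *)
Lemma cauchy_minor (C : {set 'I_n.+1}) (S : {set 'I_n}) (v : 'I_n.+1 -> F) :
  (#|C| <= #|S|)%N -> (forall c, c \notin C -> v c = 0) ->
  (forall a, a \in S -> \sum_c v c * cauchy_mx c a = 0) -> forall c, v c = 0.
Proof.
move=> CS vC vS.
pose p c : {poly F} := \prod_(d in C :\ c) ('X - (be d)%:P).
pose N := \sum_(c in C) v c *: p c.
have N0 : N = 0.
  apply/eqP/negPn/negP => N0.
  have ual : uniq [seq al a | a <- enum S] by rewrite map_inj_uniq ?enum_uniq.
  have /(max_poly_roots N0)/(_ ual) : all (root N) [seq al a | a <- enum S].
    apply/allP => _ /mapP[a aS ->]; rewrite mem_enum in aS.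
    rewrite rootE horner_sum; apply/eqP.
    transitivity ((\prod_(d in C) (al a - be d)) * \sum_c v c * cauchy_mx c a); last first.
      by rewrite vS // mulr0.
    rewrite mulr_sumr [RHS](bigID (mem C)) /= [X in _ + X]big1 ?addr0 => [|c cC]; last first.
      by rewrite vC // mul0r mulr0.
    apply: eq_bigr => c cC; rewrite hornerZ horner_prod mxE mulrCA; congr (_ * _).
    rewrite [in RHS](big_setD1 c) //= mulrAC divff ?mul1r ?subr_eq0 //.
    by apply: eq_bigr => d _; rewrite hornerXsubC.
  rewrite size_map -cardE ltnNge; apply/negP/negPn; apply: leq_trans CS.
  apply: leq_trans (size_sum _ _ _) _; apply/bigmax_leqP => c cC.
  apply: leq_trans (size_scale_leq _ _) _.
  by rewrite /p -big_enum size_prod_XsubC -cardE (cardsD1 c C) cC.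
move=> c; have [cC|/vC //] := boolP (c \in C).
(* At [be c] every [p d] with [d] different from [c] vanishes, which isolates [v c]. *)
have := congr1 (horner^~ (be c)) N0; rewrite horner0 horner_sum (bigD1 c) //=.
rewrite big1 ?addr0 => [|d /andP[dC dc]]; last first.
  rewrite hornerZ horner_prod (bigD1 c) /= ?hornerXsubC ?subrr ?mul0r ?mulr0 //.
  by rewrite !inE eq_sym dc.
move/eqP; rewrite hornerZ mulf_eq0 => /orP[/eqP //|].
rewrite horner_prod => /prodf_eq0[d]; rewrite !inE hornerXsubC subr_eq0 => /andP[dc _].
by move/eqP/be_inj => e; rewrite e eqxx in dc.
Qed.

End Cauchy.
End GenericFrame.

(** * Mixed configurations with a Cauchy frame *)

Section GenericPosition.
Variables (F : fieldType) (n : nat).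

(** The rows indexed by [C] are among [n] rows forming a basis, hence independent; [S] is a set of
    pivot columns for them. *)
Lemma frame_minor (R : 'M[F]_(n.+1, n)) (C : {set 'I_n.+1}) l : frame R -> l \notin C ->
  exists2 S : {set 'I_n}, #|S| = #|C| & forall v : 'I_n.+1 -> F,
    (forall c, c \notin C -> v c = 0) ->
    (forall a, a \in S -> \sum_c v c * R c a = 0) -> forall c, v c = 0.
Proof.
move=> fR lC; pose M := rowsub (fun k : 'I_#|C| => enum_val k) R.
have Mf : row_free M.
  rewrite -kermx_eq0; apply/eqP/row_matrixP => i; rewrite row0.
  have : (row i (kermx M) <= kermx M)%MS by exact: row_sub.
  move: (row i _) => w /sub_kermxP.
  rewrite /M rowsubE mulmxA => /(frame_ker (i := l) fR) u0.
  have {}u0 : w *m rowsub (fun k : 'I_#|C| => enum_val k) (1%:M : 'M[F]_n.+1) = 0.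
    apply: u0; rewrite mxE big1 // => k _; rewrite !mxE.
    case: eqP => [e|_]; last by rewrite mulr0.
    by case/negP: lC; rewrite -e enum_valP.
  apply/rowP => k; have /rowP/(_ (enum_val k)) := u0; rewrite !mxE (bigD1 k) //=.
  rewrite !mxE eqxx mulr1 big1 ?addr0 // => k' kk'; rewrite !mxE.
  by rewrite (inj_eq enum_val_inj) (negbTE kk') mulr0.
have Mtf : row_full M^T by rewrite /row_full mxrank_tr.
exists [set fullrankfun Mtf k | k : 'I_#|C|].
  by rewrite card_imset ?card_ord //; exact: fullrankfun_inj.
move=> v vC vS; pose w := \row_k v (enum_val k : 'I_n.+1) : 'rV[F]_#|C|.
have wM a : \sum_c v c * R c a = (w *m M) 0 a.
  rewrite (bigID (mem C)) /= [X in _ + X]big1 ?addr0 => [|c /vC ->]; last by rewrite mul0r.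
  by rewrite big_enum_val mxE; apply: eq_bigr => k _; rewrite !mxE.
have w0 : w = 0.
  have U : (rowsub (fullrankfun Mtf) M^T)^T \in unitmx.
    by rewrite unitmx_tr fullrowsub_unit.
  rewrite -[w](mulmxK U) (_ : w *m _ = 0) ?mul0mx //; apply/rowP => k.
  rewrite mxE [RHS]mxE -[RHS](vS (fullrankfun Mtf k)) ?imset_f // wM [RHS]mxE.
  by apply: eq_bigr => k' _; rewrite !mxE.
move=> c; have [cC|/vC //] := boolP (c \in C).
by have /rowP/(_ (enum_rank_in cC c)) := w0; rewrite !mxE enum_rankK_in.
Qed.

Lemma row'_mulmx l (R : 'M[F]_(n.+1, n)) (U : 'M[F]_n) :
  (row' l (R *m U) : 'M[F]_n) = (row' l R : 'M[F]_n) *m U.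
Proof. by apply/matrixP => a b; rewrite !mxE; apply: eq_bigr => k _; rewrite mxE. Qed.

Section Cauchy.
Variables (al : 'I_n -> F) (be : 'I_n.+1 -> F).
Hypotheses (al_inj : injective al) (be_inj : injective be).
Hypothesis al_be : forall a c, al a != be c.

Let P := cauchy_mx al be.

Lemma frame_cauchy : frame P.
Proof.
apply: ker_frame => l u uP ul; apply/rowP => c; rewrite mxE.
apply: (cauchy_minor al_inj be_inj al_be (C := ~: [set l]) (S := [set: 'I_n]) (v := u 0)).
- by rewrite cardsC1 cardsT !card_ord.
- by move=> d; rewrite !inE negbK => /eqP ->.
by move=> a _; have /rowP/(_ a) := uP; rewrite !mxE.
Qed.

(** Provides the nonzero pure determinants: [S] carries a nonsingular minor of the rows taken from
    [R], and its complement one of the rows taken from [P], as all square Cauchy minors are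
    nonsingular. *)
Lemma mixed_frame_selection (R : 'M[F]_(n.+1, n)) i l : frame R ->
  exists S : {set 'I_n}, \det (\matrix_(a, b) (if a \in S
     then (if (lift l b < i)%N then 0 else R (lift l b) a)
     else (if (lift l b < i)%N then P (lift l b) a else 0))) != 0.
Proof.
move=> fR; pose C : {set 'I_n.+1} := [set j : 'I_n.+1 | (i <= j)%N && (j != l)]%SET.
have lC : l \notin C by rewrite inE eqxx andbF.
have [S cS SP] := frame_minor fR lC; exists S.
rewrite -unitfE -unitmxE -unitmx_tr; apply: unitmx_ker => v vM.
pose u j := if unlift l j is Some b then v 0 b else 0.
have ul : u l = 0 by rewrite /u unlift_none.
have sumE (f : 'I_n.+1 -> F) : \sum_j u j * f j = \sum_b v 0 b * f (lift l b).
  rewrite (bigD1_ord l) //= ul mul0r add0r; apply: eq_bigr => b _.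
  by rewrite /u liftK.
(* A kernel vector is split into its parts on the rows of [R] and of [P], which the two minors kill
   separately. *)
pose u1 (j : 'I_n.+1) := if (i <= j)%N then u j else 0.
pose u2 (j : 'I_n.+1) := if (i <= j)%N then 0 else u j.
have u10 : forall j, u1 j = 0.
  apply: SP => [j|a aS].
    by rewrite inE negb_and negbK /u1 => /orP[/negbTE ->//|/eqP ->]; rewrite ul if_same.
  have /rowP/(_ a) := vM; rewrite !mxE => vMa.
  rewrite -[RHS]vMa; under [RHS]eq_bigr do rewrite [X in _ * X]mxE [X in _ * X]mxE aS.
  rewrite -(sumE (fun j => if (j < i)%N then 0 else R j a)); apply: eq_bigr => j _.
  by rewrite /u1 ltnNge; case: (i <= j)%N => //=; rewrite mul0r mulr0.
have u20 : forall j, u2 j = 0.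
  apply: (cauchy_minor al_inj be_inj al_be
    (C := [set j : 'I_n.+1 | (j < i)%N && (j != l)]%SET) (S := ~: S)).
  - rewrite [X in (_ <= X)%N]cardsCs finset.setCK cS card_ord.
    rewrite leq_subRL; last first.
      rewrite -[X in (_ <= X)%N](card_ord n) -cS; exact: max_card.
    rewrite -cardsUI (_ : _ :&: _ = finset.set0) ?cards0 ?addn0; last first.
      by apply/finset.setP => j; rewrite !inE; case: leqP; rewrite ?andbF.
    apply: (@leq_trans #|~: [set l]|); last by rewrite cardsC1 card_ord.
    by apply: subset_leq_card; apply/fintype.subsetP => j; rewrite !inE -andb_orl => /andP[].
  - move=> j; rewrite inE negb_and negbK -leqNgt /u2 => /orP[->//|/eqP ->].
    by rewrite ul if_same.
  move=> a; rewrite inE => /negbTE aS.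
  have /rowP/(_ a) := vM; rewrite !mxE => vMa.
  rewrite -[RHS]vMa; under [RHS]eq_bigr do rewrite [X in _ * X]mxE [X in _ * X]mxE aS.
  rewrite -(sumE (fun j => if (j < i)%N then P j a else 0)); apply: eq_bigr => j _.
  by rewrite /u2 ltnNge; case: (i <= j)%N => //=; rewrite mul0r mulr0.
have u0 j : u j = 0.
  by have := u10 j; have := u20 j; rewrite /u1 /u2; case: ifP.
by apply/rowP => b; rewrite mxE; have := u0 (lift l b); rewrite /u liftK.
Qed.

(* The pairs (i, l) with l = i need not be imposed: omitting the i-th row
   gives the same matrix at steps i and i + 1. This leaves exactly n^2
   conditions, and the one with i = 1, l = 0 forces x to be nonzero. *)
Lemma generic_diagonal (s : seq F) (R : 'M[F]_(n.+1, n)) :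
  (0 < n)%N -> uniq s -> (n ^ 2 < size s)%N -> frame R ->
  exists2 x : 'rV[F]_n, diag_mx x \in unitmx &
    forall i, (i <= n.+1)%N -> frame (mixed_frame P (R *m diag_mx x) i).
Proof.
move=> n0 us ns fR.
(* A pair [j] encodes [i = lift ord0 j.1], between 1 and [n], and [l = lift i j.2], different from
   [i]. *)
pose J := ('I_n * 'I_n)%type.
pose li (j : J) : 'I_n.+1 := lift ord0 j.1.
pose A (j : J) : 'M[F]_n := \matrix_(a, b)
  (if (lift (lift (li j) j.2) b < li j)%N then 0 else R (lift (lift (li j) j.2) b) a).
pose B (j : J) : 'M[F]_n := \matrix_(a, b)
  (if (lift (lift (li j) j.2) b < li j)%N then P (lift (lift (li j) j.2) b) a else 0).
have [||x xP] := @multiaffine_nonvanishing F n J A B s us.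
- by rewrite card_prod card_ord mulnn.
- move=> j; have [S SP] := mixed_frame_selection (li j) (lift (li j) j.2) fR.
  exists S; move: SP; congr (\det _ != 0); apply/matrixP => a b; rewrite !mxE.
  by [].
pose d := \row_a x a.
have RdE c a : (R *m diag_mx d) c a = R c a * x a by rewrite mul_mx_diag !mxE.
have good (i l : 'I_n.+1) : i != ord0 -> l != i ->
    (row' l (mixed_frame P (R *m diag_mx d) i) : 'M[F]_n) \in unitmx.
  case: (unliftP ord0 i) => [i' ->|->]; last by rewrite eqxx.
  case: (unliftP (lift ord0 i') l) => [l' ->|->]; last by rewrite eqxx.
  move=> _ _; rewrite unitmxE unitfE -det_tr; have := xP (i', l'); congr (\det _ != 0).
  apply/matrixP => a b; rewrite [LHS]mxE 3![RHS]mxE RdE [A _ _ _]mxE [B _ _ _]mxE /=.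
  by case: ifP => _; rewrite ?mulr0 ?add0r ?addr0 // mulrC.
have dU : diag_mx d \in unitmx.
  have := good (lift ord0 (Ordinal n0)) ord0 isT isT.
  have -> : (row' ord0 (mixed_frame P (R *m diag_mx d) (lift ord0 (Ordinal n0))) : 'M[F]_n) =
            row' ord0 (R *m diag_mx d).
    by apply/matrixP => a b; rewrite [LHS]mxE [LHS]mxE [RHS]mxE.
  by rewrite row'_mulmx unitmx_mul => /andP[].
have fQ : frame (R *m diag_mx d).
  by move=> l; rewrite row'_mulmx unitmx_mul fR.
have M0 : mixed_frame P (R *m diag_mx d) 0 = R *m diag_mx d.
  by apply/matrixP => a b; rewrite !mxE.
have MN : mixed_frame P (R *m diag_mx d) n.+1 = P.
  by apply/matrixP => a b; rewrite mxE ltn_ord.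
exists d => // i; rewrite leq_eqVlt => /predU1P[->|iN].
  by rewrite MN; exact: frame_cauchy.
move=> l; case: (posnP i) => [->|i0]; first by rewrite M0; exact: fQ.
have [e|li'] := eqVneq l (Ordinal iN); last first.
  by apply: (good (Ordinal iN) l) => //; rewrite -(inj_eq val_inj) /= -lt0n.
have step : row' l (mixed_frame P (R *m diag_mx d) i) =
            row' l (mixed_frame P (R *m diag_mx d) i.+1).
  apply/matrixP => a b; rewrite ![row' _ _ _ _]mxE ![mixed_frame _ _ _ _ _]mxE ltnS.
  suff -> : (lift l a < i)%N = (lift l a <= i)%N by [].
  by rewrite e /= /bump; case: leqP => //; lia.
rewrite step; have iNn := iN; rewrite ltnS leq_eqVlt in iNn.
case/predU1P: iNn => [iE|iN']; first by rewrite [in i.+1]iE MN; exact: frame_cauchy.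
have iN1 : (i.+1 < n.+1)%N by rewrite ltnS.
by apply: (good (Ordinal iN1) l) => //; rewrite e -(inj_eq val_inj) /=; lia.
Qed.

End Cauchy.
End GenericPosition.

(** * Parametrization of products of tori *)

Section ProductParametrization.
Variables (F : fieldType) (m r : nat).
Local Notation n := m.+1.
Local Notation k := (r * m).+1.
Variable h : 'I_r -> GL F n.

(* Every element of the diagonal torus has a unique representative with first
   entry 1. The coordinate of index 0 is a global scalar. *)
Definition torus_coords (x : 'I_k -> F) (i : 'I_r) : 'rV[F]_n :=
  \row_j (if unlift ord0 j is Some j' then x (lift ord0 (mxvec_index i j')) else 1).

Definition torus_factor (x : 'I_k -> F) (i : 'I_r) : 'M[F]_n :=
  invmx (GLmx (h i)) *m (diag_mx (torus_coords x i) *m GLmx (h i)).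

Definition product_mx (x : 'I_k -> F) : 'M[F]_n :=
  x ord0 *: \prod_(i < r) torus_factor x i.

Definition polymx (f : ('I_k -> F) -> 'M[F]_n) : Prop :=
  forall a b, exists p : mpoly k F, forall x, f x a b = meval x p.

Lemma polymxM f g : polymx f -> polymx g -> polymx (fun x => f x *m g x).
Proof.
move=> fP gP a b; have [p pP] := choice (fP a).
have [q qP] := choice (fun c => gP c b).
exists (\sum_c p c * q c) => x; rewrite mxE raddf_sum; apply: eq_bigr => c _ /=.
by rewrite mevalM pP qP.
Qed.

Lemma polymxC (A : 'M[F]_n) : polymx (fun=> A).
Proof. by move=> a b; exists (mpolyC _ (A a b)) => x; rewrite mevalC. Qed.

Lemma polymap_product : polymap (fun x => mxpt (product_mx x)).
Proof.
have fP i : polymx (torus_factor^~ i).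
  apply: polymxM; first exact: polymxC.
  apply: polymxM; last exact: polymxC.
  move=> a b; exists (if a == b then (if unlift ord0 b is Some j then
     mpolyX F (mnm1 (lift ord0 (mxvec_index i j))) else 1) else 0) => x.
  rewrite !mxE; case: eqP => [->|_]; rewrite ?mulr0n ?meval0 // mulr1n.
  by case: unlift => [j|]; rewrite ?mevalXU ?meval1.
have pP : polymx (fun x => \prod_(i < r) torus_factor x i).
  elim: (index_enum _) => [|i s IHs].
    by move=> a b; have [p pP] := polymxC 1 a b; exists p => x; rewrite big_nil -pP.
  move=> a b; have [p pP] := polymxM (fP i) IHs a b.
  by exists p => x; rewrite big_cons -pP.
move=> j; case: (mxvec_indexP j) => a b; have [p pE] := pP a b.
exists (mpolyX F (mnm1 ord0) * p) => x.
by rewrite /mxpt mxvecE mxE mevalM mevalXU pE.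
Qed.

Lemma diag_mx_unit (d : 'rV[F]_n) : (forall j, d 0 j != 0) -> diag_mx d \in unitmx.
Proof. by move=> d0; rewrite unitmxE det_diag unitfE; apply/prodf_neq0. Qed.

Lemma PGL_pi_prod (A : 'I_r -> GL F n) :
  PGL_pi (\prod_i A i)%g = (\prod_i PGL_pi (A i))%g.
Proof. by rewrite (big_morph _ (fun A B => esym (PGL_piM A B)) (PGL_pi1 F n)). Qed.

Lemma GLmx_prod (A : 'I_r -> GL F n) : GLmx (\prod_i A i)%g = \prod_i GLmx (A i).
Proof.
by rewrite (big_morph (@GLmx F n) (id1 := 1) (op1 := *%R)).
Qed.

Lemma product_mxP (x : 'I_k -> F) : (forall j, x j != 0) ->
  exists (A : GL F n) (D : 'I_r -> GL F n),
    [/\ GLmx A = product_mx x, forall i, GLmx (D i) = diag_mx (torus_coords x i)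
      & PGL_pi A = (\prod_i conjg (PGL_pi (D i)) (PGL_pi (h i)))%g].
Proof.
move=> x0; have dU i : diag_mx (torus_coords x i) \in unitmx.
  by apply: diag_mx_unit => j; rewrite mxE; case: unlift => [a|]; rewrite ?oner_neq0.
pose D i := MkGL (dU i); pose B := (\prod_i ((h i)^-1 * (D i * h i)))%g.
exists (MkGL (GL_scale_unit B (x0 ord0))), D; split=> //=.
  by rewrite /product_mx GLmx_prod.
rewrite (_ : PGL_pi (MkGL _) = PGL_pi B); last first.
  by apply/PGL_pi_eq; exists (x ord0).
by rewrite /B PGL_pi_prod; apply: eq_bigr => i _; rewrite PGL_piJ.
Qed.

(** The packing recovers each factor in PGL, the normalized first diagonal entry then recovers its
    coordinates, and the global scalar follows since the product has a nonzero entry. *)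
Lemma product_mx_inj (T : 'I_r -> set (PGL F n)) (x y : 'I_k -> F) :
  toric_packing T ->
  (forall i, T i = [set conjg t (PGL_pi (h i)) | t in @diag_torus F n]) ->
  (forall j, x j != 0) -> (forall j, y j != 0) ->
  product_mx x = product_mx y -> x = y.
Proof.
move=> [_ Tinj] TE x0 y0 xy.
have [A [D [AE DE Ap]]] := product_mxP x0.
have [A' [D' [AE' DE' Ap']]] := product_mxP y0.
have AA' : A = A' by apply: val_inj; rewrite /= AE AE'.
pose t : {ffun 'I_r -> PGL F n} := [ffun i => conjg (PGL_pi (D i)) (PGL_pi (h i))].
pose t' : {ffun 'I_r -> PGL F n} := [ffun i => conjg (PGL_pi (D' i)) (PGL_pi (h i))].
have tt' : t = t'.
  apply: Tinj.
  - rewrite inE => i; rewrite ffunE TE; exists (PGL_pi (D i)) => //.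
    by exists (D i) => //=; rewrite DE diag_mx_is_diag.
  - rewrite inE => i; rewrite ffunE TE; exists (PGL_pi (D' i)) => //.
    by exists (D' i) => //=; rewrite DE' diag_mx_is_diag.
  rewrite /mul_map; under eq_bigr do rewrite ffunE.
  by under [RHS]eq_bigr do rewrite ffunE; rewrite -Ap -Ap' AA'.
have xyl i j : x (lift ord0 (mxvec_index i j)) = y (lift ord0 (mxvec_index i j)).
  have /ffunP/(_ i) := tt'; rewrite !ffunE => /conjg_inj/PGL_pi_eq[c c0].
  rewrite DE DE' => e.
  have c1 : c = 1.
    have /matrixP/(_ ord0 ord0) := e; rewrite !mxE eqxx unlift_none !mulr1n mulr1.
    by move/esym.
  have /matrixP/(_ (lift ord0 j) (lift ord0 j)) := e.
  by rewrite !mxE eqxx liftK !mulr1n c1 mul1r.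
have fE : torus_factor x = torus_factor y.
  apply/funext => i; rewrite /torus_factor; congr (_ *m (diag_mx _ *m _)).
  by apply/rowP => j; rewrite !mxE; case: unlift => [j'|].
apply/funext => j; case: (unliftP ord0 j) => [j' ->|->].
  by case: (mxvec_indexP j').
move: xy; rewrite /product_mx fE => xy.
have : product_mx y \in unitmx by rewrite -AE' GLmx_unit.
rewrite /product_mx; set Q := \prod_i _ in xy *.
have [a [b Qab]] : exists a b, Q a b != 0.
  apply: contrapT => nQ; have Q0 : Q = 0.
    apply/matrixP => a b; rewrite mxE; apply/eqP/negPn/negP => Qab.
    by apply: nQ; exists a, b.
  by have := GLmx_unit A'; rewrite AE' /product_mx -/Q Q0 scaler0 unitmxE det0 unitr0.
by have /matrixP/(_ a b) := xy; rewrite !mxE => /(mulIf Qab).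
Qed.

(** Each diagonal factor is rescaled to first entry 1; the leftover scalar becomes the coordinate of
    index 0. *)
Lemma product_mx_surj (T : 'I_r -> set (PGL F n)) (A : GL F n)
    (t : {ffun 'I_r -> PGL F n}) :
  (forall i, T i = [set conjg t (PGL_pi (h i)) | t in @diag_torus F n]) ->
  torus_product T t -> mul_map t = PGL_pi A -> range product_mx (GLmx A).
Proof.
move=> TE tT tA.
have /choice[D DP] : forall i, exists D : GL F n, [/\ is_diag_mx (GLmx D),
    GLmx D ord0 ord0 = 1 & t i = conjg (PGL_pi D) (PGL_pi (h i))].
  move=> i; have := tT i; rewrite TE => -[_ [D /= Dd <-] <-].
  have /diag_mxP[d dE] := Dd.
  have d0 : d 0 ord0 != 0.
    have := GLmx_unit D; rewrite dE unitmxE det_diag unitfE.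
    by move/prodf_neq0; apply.
  have d0V : (d 0 ord0)^-1 != 0 by rewrite invr_neq0.
  exists (MkGL (GL_scale_unit D d0V)); split => /=.
  - by rewrite dE -linearZ diag_mx_is_diag.
  - by rewrite dE !mxE eqxx mulr1n mulVf.
  - congr conjg; apply/PGL_pi_eq; exists (d 0 ord0) => //=.
    by rewrite scalerA divff // scale1r.
have AE : PGL_pi A = PGL_pi (\prod_i ((h i)^-1 * (D i * h i)))%g.
  rewrite -tA /mul_map PGL_pi_prod; apply: eq_bigr => i _.
  by have [_ _ ->] := DP i; rewrite PGL_piJ.
have /PGL_pi_eq[c c0 {}AE] := AE.
pose y (j : 'I_k) := if unlift ord0 j is Some j' then
  mxvec (\matrix_(i, a) GLmx (D i) (lift ord0 a) (lift ord0 a) : 'M[F]_(r, m)) 0 j' else c.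
exists y => //; rewrite AE GLmx_prod /product_mx /y unlift_none; congr (_ *: _).
apply: eq_bigr => i _; rewrite /torus_factor /=; congr (_ *m (_ *m _)).
have [/diag_mxP[d dE] D0 _] := DP i.
rewrite dE; congr diag_mx; apply/rowP => j; rewrite mxE.
case: (unliftP ord0 j) => [j' ->|->].
  by rewrite liftK mxvecE !mxE dE mxE eqxx mulr1n.
by rewrite -D0 dE mxE eqxx mulr1n.
Qed.

End ProductParametrization.

(** * Tori and the standard frame *)

Section ToriDimension.
Variables (F : fieldType) (n : nat).
Hypothesis Finf : infinite_set [set: F].
Hypothesis n0 : (0 < n)%N.

Lemma PGL_subspace_image : [set: PGL F n] = subspace_image (1%:M : 'M[F]_(n * n)).
Proof.
apply/seteqP; split => // z _; rewrite -(PGL_piK z).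
by apply/subspace_imageE; exact: submx1.
Qed.

Lemma krull_dim_PGL : krull_dim [set: PGL F n] = ((n * n).-1)%:R%:E.
Proof.
by rewrite PGL_subspace_image krull_dim_subspace_image ?mxrank1 ?submx1.
Qed.

(** The torus is the linear section by the conjugated diagonal matrices, an [n]-dimensional space
    containing the identity. *)
Lemma krull_dim_torus (T : set (PGL F n)) : split_maximal_torus T ->
  krull_dim T = (n.-1)%:R%:E.
Proof.
move=> [g ->]; rewrite -(PGL_piK g); set h := repr g.
pose f (d : 'rV[F]_n) := mxvec (invmx (GLmx h) *m (diag_mx d *m GLmx h)).
have f_lin : linear f.
  move=> a u v; rewrite /f linearP /= mulmxDl mulmxDr -scalemxAl -scalemxAr.
  by rewrite linearP.
pose fL : {linear 'rV[F]_n -> 'rV[F]_(n * n)} :=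
  HB.pack f (GRing.isLinear.Build _ _ _ _ f f_lin).
pose V := lin1_mx fL.
have VE d : d *m V = f d by rewrite mul_rV_lin1.
have f_inj d : f d = 0 -> d = 0.
  rewrite -[RHS](linear0 (mxvec : 'M[F]_n -> _)) => /(can_inj mxvecK).
  move=> /(congr1 (fun M => GLmx h *m M *m invmx (GLmx h))).
  rewrite mulmx0 mul0mx mulmxA mulmxV ?GLmx_unit // mul1mx mulmxK ?GLmx_unit // => d0.
  by apply/rowP => j; have /matrixP/(_ j j) := d0; rewrite !mxE eqxx mulr1n.
have rV : \rank V = n.
  apply/eqP; rewrite -/(row_free V) -kermx_eq0; apply/eqP/row_matrixP => i.
  by rewrite row0; apply: f_inj; rewrite -VE; apply/sub_kermxP; exact: row_sub.
have V1 : (mxvec 1%:M <= V)%MS.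
  apply/submxP; exists (const_mx 1); rewrite VE /f diag_const_mx mul1mx.
  by rewrite mulVmx ?GLmx_unit.
rewrite -[in RHS]rV -(krull_dim_subspace_image Finf n0 V1); congr krull_dim.
apply/seteqP; split => z.
  move=> [_ [D /= /diag_mxP[d dE] <-] <-]; rewrite PGL_piJ.
  by apply/subspace_imageE; rewrite /= dE -/(f d) -VE submxMl.
rewrite -(PGL_piK z) => /subspace_imageE/submxP[d]; rewrite VE => /(can_inj mxvecK).
set A := repr z => AE.
have DE : GLmx (h * A * h^-1)%g = diag_mx d.
  rewrite /= AE mulmxA mulmxV ?GLmx_unit // mul1mx mulmxK ?GLmx_unit //.
exists (PGL_pi (h * A * h^-1)%g).
  by exists (h * A * h^-1)%g => //; rewrite /mkset DE diag_mx_is_diag.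
by rewrite PGL_piJ -!mulgA mulVg mulg1 !mulgA mulVg mul1g.
Qed.

End ToriDimension.

Section StandardFrame.
Variables (F : fieldType) (n : nat).

(** The standard basis followed by the all-ones vector, a frame over every field. *)
Definition std_frame : 'M[F]_(n.+1, n) :=
  \matrix_(j, a) (if unlift ord_max j is Some b then (b == a)%:R else 1).

Lemma frame_std : frame std_frame.
Proof.
apply: ker_frame => i u uP ui.
have ua a : u 0 (lift ord_max a) = - u 0 ord_max.
  apply/eqP; rewrite -addr_eq0 addrC; apply/eqP.
  have /rowP/(_ a) := uP; rewrite !mxE (bigD1_ord ord_max) //= mxE unlift_none mulr1.
  rewrite (bigD1 a) //= mxE liftK eqxx mulr1 big1 ?addr0 // => b ba.
  by rewrite mxE liftK (negbTE ba) mulr0.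
have umax : u 0 ord_max = 0.
  move: ui; case: (unliftP ord_max i) => [a ->|-> //].
  by rewrite ua => /eqP; rewrite oppr_eq0 => /eqP.
apply/rowP => j; rewrite mxE; case: (unliftP ord_max j) => [a ->|-> //].
by rewrite ua umax oppr0.
Qed.

(* An element carrying the last line of the frame to the first one is not a
   product of the tori: all factors but the last fix the last line, and the
   last factor fixes the first line. *)
Lemma frame_packing_not_onto (P : 'M[F]_(n.+1, n)) (fP : frame P) : (1 < n)%N ->
  exists z, forall t : 'I_n.+1 -> PGL F n,
    (forall i, frame_torus fP i (t i)) -> (\prod_i t i)%g <> z.
Proof.
move=> n1; pose s := tperm (ord0 : 'I_n.+1) ord_max.
have fR : frame (row_perm s P).
  apply: ker_frame => i u uR ui.
  have := frame_ker (u := col_perm s^-1 u) (i := s i) fP.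
  rewrite mxE permK ui => /(_ _ erefl) H.
  have {}H : col_perm s^-1 u = 0.
    apply: H; rewrite -[RHS]uR; apply/rowP => a; rewrite !mxE (reindex_inj (@perm_inj _ s)).
    by apply: eq_bigr => j _; rewrite !mxE permK.
  apply/rowP => j; have /rowP/(_ (s j)) := H.
  by rewrite !mxE permK.
have [G [c cP]] := frame_transfer fP fR.
have [c0] := cP ord_max; rewrite (_ : row ord_max (row_perm s P) = row ord0 P); last first.
  by apply/rowP => a; rewrite !mxE tpermR.
move=> GE; exists (PGL_pi G) => t tT tG.
have n0 : (ord0 : 'I_n.+1) != ord_max by rewrite -(inj_eq val_inj) /= eq_sym -lt0n ltnW.
pose a := (\prod_(i < n) t (widen_ord (leqnSn n) i))%g.
have aP : fixes_line P ord_max a.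
  apply: (big_ind (fixes_line P ord_max)).
  - exact: fixes_line1.
  - exact: fixes_lineM.
  move=> i _; apply: (frame_torusP _ _ _).1 (tT _) _ _.
  by rewrite -(inj_eq val_inj) /= neq_ltn ltn_ord orbT.
have tP : fixes_line P ord0 ((t ord_max)^-1)%g.
  by apply: fixes_lineV; apply: (frame_torusP _ _ _).1 (tT _) _ n0.
have aE : a = (PGL_pi G * (t ord_max)^-1)%g by rewrite -tG big_ord_recr mulgK.
move: aP tP; rewrite aE -[(t ord_max)^-1%g]PGL_piK PGL_piM.
set B := repr _ => /fixes_lineP[l lE] /fixes_lineP[l' l'E].
move: lE; rewrite /= mulmxA GE -scalemxAl l'E scalerA => lE.
have l'0 : l' != 0.
  apply: contra_neq (oner_neq0 F) => l'0.
  have r0 : row ord0 P = 0.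
    by rewrite -[LHS](mulmxK (GLmx_unit B)) l'E l'0 scale0r mul0mx.
  have := frame_ker (u := delta_mx 0 ord0) (i := ord_max) fP.
  rewrite -rowE r0 mxE eq_sym (negbTE n0) andbF => /(_ erefl erefl)/rowP/(_ ord0).
  by rewrite !mxE !eqxx.
(* Since [1 < n], the index 1 is neither first nor last; a relation between the first and last rows
   has coefficient zero there, hence is trivial. *)
pose j1 : 'I_n.+1 := Ordinal (ltn_trans n1 (ltnSn n)).
have := frame_ker (u := (c ord_max * l') *: delta_mx 0 ord0 - l *: delta_mx 0 ord_max)
  (i := j1) fP.
rewrite mulmxBl -!scalemxAl -!rowE lE subrr !mxE.
rewrite -!(inj_eq val_inj) /= (ltn_eqF n1) !mulr0 subr0 => /(_ erefl erefl)/rowP/(_ ord0).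
rewrite !mxE eqxx (negbTE n0) !mulr0 subr0 mulr1 => /eqP.
by rewrite mulf_eq0 (negbTE c0) (negbTE l'0).
Qed.

End StandardFrame.

(** * Cardinality of the field and of the group *)

Section Bounds.
Variables (F : fieldType).

(** If finitely many elements exhausted the field, 1 plus the product of all [X - a] would have no
    root. *)
Lemma closed_field_infinite : GRing.closed_field_axiom F -> infinite_set [set: F].
Proof.
move=> Fcl /finite_seqP[s sE].
have sP x : x \in s by have : [set: F] x by []; rewrite sE.
pose p := \prod_(a <- s) ('X - a%:P).
have szp : size p = (size s).+1 by rewrite size_prod_XsubC.
have s0 : (0 < size s)%N by case: (s) (sP 0).
have [|x] := PreClosedField.closed_rootP Fcl (p + 1) _.
  by rewrite size_polyDl szp ?size_poly1 ?ltnS // eqSS -lt0n.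
have : root p x by rewrite root_prod_XsubC.
by rewrite !rootE hornerD hornerC => /eqP -> /eqP; rewrite add0r => /eqP; rewrite oner_eq0.
Qed.

Lemma card_le_uniq_seq (N : nat) : `I_N #<= [set: F] ->
  exists2 s : seq F, uniq s & size s = N.
Proof.
move=> /card_leP[f].
have iN (i : 'I_N) : (i : nat) \in `I_N by rewrite inE /=.
pose u (i : 'I_N) : F := val (f (SigSub (iN i))).
exists [seq u i | i <- enum 'I_N]; last by rewrite size_map size_enum_ord.
rewrite map_inj_uniq ?enum_uniq // => i j /val_inj fij.
have /(congr1 val)/= ij : SigSub (iN i) = SigSub (iN j) by apply: (inj (f := f)); rewrite ?inE.
exact: val_inj.
Qed.

(* Bernoulli, applied separately to the two halves of the exponent so that each
   factor costs at most 2. *)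
Lemma ltn_expS (p N : nat) : (3 < N)%N -> (N <= p)%N -> (p.+1 ^ N < p ^ N.+1)%N.
Proof.
move=> N3 Np; have p0 : (0 < p)%N by lia.
have bern j : (j <= p.+1)%N -> (p.+1 ^ j * (p.+1 - j) <= p ^ j * p.+1)%N.
  elim: j => [|j IHj] jp; first by rewrite !expn0 subn0.
  apply: (@leq_trans (p * (p.+1 ^ j * (p.+1 - j)))%N).
    rewrite expnS -mulnA mulnCA [X in (_ <= X)%N]mulnCA leq_mul2l; apply/orP; right; nia.
  by rewrite expnS -mulnA leq_mul2l IHj ?orbT // ltnW.
have [a [b [Nab ab ba]]] : exists a b, [/\ N = (a + b)%N, (a <= b)%N & (b <= a.+1)%N].
  exists N./2, (uphalf N); have := odd_double_half N; have := uphalf_half N.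
  by case: (odd N) => /=; split; lia.
have pa : (0 < p ^ a)%N by rewrite expn_gt0 p0.
have pb : (0 < p ^ b)%N by rewrite expn_gt0 p0.
have h1 : (p.+1 ^ a < 2 * p ^ a)%N.
  have := bern a; set u := (p.+1 ^ a)%N; set v := (p ^ a)%N in pa *.
  by move=> /(_ ltac:(lia)); nia.
have h2 : (p.+1 ^ b <= 2 * p ^ b)%N.
  have := bern b; set u := (p.+1 ^ b)%N; set v := (p ^ b)%N in pb *.
  by move=> /(_ ltac:(lia)); nia.
rewrite expnS Nab !expnD; set u := (p.+1 ^ a)%N in h1 *; set u' := (p.+1 ^ b)%N in h2 *.
apply: (@leq_trans (4 * (p ^ a * p ^ b))%N); last by rewrite leq_mul2r; apply/orP; right; lia.
apply: (@leq_ltn_trans (u * (2 * p ^ b))%N); first by rewrite leq_mul2l h2 orbT.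
by rewrite -[4%N]/(2 * 2)%N mulnACA ltn_mul2r muln_gt0 pb h1.
Qed.

Lemma finite_PGL n : finite_set [set: F] -> finite_set [set: PGL F n].
Proof.
move=> /finite_seqP[s sE].
have sP x : x \in s by have : [set: F] x by []; rewrite sE.
pose mx (f : {ffun 'I_n * 'I_n -> seq_sub s}) : 'M[F]_n := \matrix_(i, j) ssval (f (i, j)).
pose g f : PGL F n := if insub (mx f) is Some A then PGL_pi A else 1%g.
have -> : [set: PGL F n] = g @` setT.
  apply/seteqP; split => // z _; rewrite -(PGL_piK z); set A := repr z.
  exists [ffun ij => SeqSub (sP (GLmx A ij.1 ij.2))] => //.
  rewrite /g (_ : mx _ = val A) ?valK //.
  by apply/matrixP => i j; rewrite mxE ffunE.
exact/finite_image/finite_finset.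
Qed.

End Bounds.

(** * Existence of packings and coverings *)

Section Packings.
Variables (F : fieldType) (n : nat).

Lemma split_torusP (I : Type) (T : I -> set (PGL F n)) :
  (forall i, split_maximal_torus (T i)) -> exists h : I -> GL F n,
  forall i, T i = [set conjg t (PGL_pi (h i)) | t in @diag_torus F n].
Proof.
move=> /choice[g gP]; exists (fun i => repr (g i)) => i.
by rewrite gP PGL_piK.
Qed.

Lemma packing_exists : exists T : 'I_n.+1 -> set (PGL F n), toric_packing T.
Proof. exists (frame_torus (@frame_std F n)); exact: frame_packing. Qed.

Lemma split_diag_torus : split_maximal_torus (@diag_torus F n).
Proof.
exists 1%g; apply/seteqP; split => z; first by move=> zD; exists z; rewrite ?conjg1.
by move=> [t tD <-]; rewrite conjg1.
Qed.

Lemma diag_torusV z : @diag_torus F n z -> @diag_torus F n (z^-1)%g.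
Proof.
move=> [A /= Ad <-]; rewrite PGL_piV; exists (A^-1)%g => //=.
have /diag_mxP[d dE] := Ad.
have d0 j : d 0 j != 0.
  by have := GLmx_unit A; rewrite dE unitmxE det_diag unitfE => /prodf_neq0; apply.
have -> : invmx (GLmx A) = diag_mx (\row_j (d 0 j)^-1); last exact: diag_mx_is_diag.
rewrite -[RHS](mulKmx (GLmx_unit A)) dE (_ : _ *m diag_mx _ = 1%:M) ?mulmx1 //.
apply/matrixP => i j; rewrite mul_diag_mx !mxE.
by case: eqP => [->|_]; rewrite ?mulr1n ?mulr0n ?mulr0 // mulfV.
Qed.

(** The tori of a Cauchy frame are followed by the diagonal torus. A generic diagonal [D] makes
    [g * D] a product over the frame, and [D^-1] is the last factor. *)
Lemma covering_exists (s : seq F) : (1 < n)%N -> uniq s -> (n ^ 2 < size s)%N ->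
  exists T : 'I_n.+2 -> set (PGL F n), toric_covering T.
Proof.
move=> n1 us ns.
(* The Cauchy nodes need [2 n + 1] distinct elements, and [2 n <= n^2] as [1 < n]. *)
have ssz : (n + n.+1 <= size s)%N.
  by apply: leq_trans ns; rewrite -mulnn; nia.
pose al (i : 'I_n) := nth 0 s i; pose be (j : 'I_n.+1) := nth 0 s (n + j).
have ali (i : 'I_n) : (i < size s)%N by have := ltn_ord i; lia.
have bei (j : 'I_n.+1) : (n + j < size s)%N by have := ltn_ord j; lia.
have al_inj : injective al.
  by move=> i j /eqP; rewrite nth_uniq // => /eqP ij; exact: val_inj.
have be_inj : injective be.
  by move=> i j /eqP; rewrite nth_uniq // eqn_add2l => /eqP ij; exact: val_inj.
have al_be a c : al a != be c.
  by rewrite nth_uniq //; have := ltn_ord a; lia.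
pose P := cauchy_mx al be.
have fP : frame P by exact: frame_cauchy.
pose T i := if unlift ord_max i is Some j then frame_torus fP j else @diag_torus F n.
exists T; split=> [i|z _].
  rewrite /T; case: unlift => [j|]; [exact: split_frame_torus|exact: split_diag_torus].
rewrite -(PGL_piK z); set g := repr z.
have fPg : frame (P *m GLmx g).
  by move=> l; rewrite row'_mulmx unitmx_mul fP GLmx_unit.
have [d dU dP] := generic_diagonal al_inj be_inj al_be (ltnW n1) us ns fPg.
pose D := MkGL dU.
have [t [tT tE]] : exists t : 'I_n.+1 -> PGL F n,
    (forall i, frame_torus fP i (t i)) /\ PGL_pi (g * D)%g = (\prod_i t i)%g.
  by apply: frame_factorization => i iN; rewrite /= mulmxA; exact: dP.
have DT : diag_torus (PGL_pi D) by exists D => //=; exact: diag_mx_is_diag.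
exists [ffun i => if unlift ord_max i is Some j then t j else (PGL_pi D)^-1%g].
  move=> i; rewrite ffunE /T; case: unlift => [j|]; first exact: tT.
  exact: diag_torusV.
rewrite /mul_map big_ord_recr /= ffunE unlift_none.
rewrite (eq_bigr t) => [|i _]; last first.
  rewrite ffunE (_ : widen_ord _ _ = lift ord_max i) ?liftK //.
  by apply: val_inj; rewrite /= /bump leqNgt ltn_ord.
by rewrite -tE -PGL_piM mulgK.
Qed.

End Packings.

(** * Bounds and the theorem *)

Section PackingCoveringBounds.
Variables (F : fieldType) (m r : nat).
Local Notation n := m.+1.
Variable T : 'I_r -> set (PGL F n).

Lemma packing_bound_closed : (0 < m)%N -> GRing.closed_field_axiom F ->
  toric_packing T -> (r <= n.+1)%N.
Proof.
move=> m0 Fcl Tp; have [h hE] := split_torusP Tp.1.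
rewrite leqNgt; apply/negP => rn.
(* If [r >= n + 2], then [r m + 1 >= (n + 2) (n - 1) + 1 = n^2 + n - 1 > n^2]. *)
have kN : (n * n < (r * m).+1)%N by nia.
have [x [y [x0 y0 xy fxy]]] :=
  no_injective_polymap Fcl (closed_field_infinite Fcl) (polymap_product h) kN.
apply: xy; apply: (product_mx_inj Tp hE x0 y0).
by apply: (can_inj mxvecK); apply/rowP => j; exact: (congr1 (fun u => u j) fxy).
Qed.

Lemma covering_bound_closed : (0 < m)%N -> GRing.closed_field_axiom F ->
  toric_covering T -> (n.+1 <= r)%N.
Proof.
move=> m0 Fcl [Ts Tc]; have [h hE] := split_torusP Ts.
have Finf := closed_field_infinite Fcl.
(* Here [n^2 - 1 = m (m + 2)], and [m] is positive. *)
suff : ((n * n).-1 <= r * m)%N by nia.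
rewrite -(ler_nat Rdefinitions.R) -lee_fin -(krull_dim_PGL Finf (ltn0Sn m)).
apply: ge_ereal_sup => _ [d [Z [Zi Zlt]] <-]; rewrite lee_fin ler_nat -ltnS.
apply: (krull_chain_length Finf (ltn0Sn m) (polymap_product h)) Zi Zlt => A _.
have [t tT tA] := Tc (PGL_pi A) I.
have [x _ xA] := product_mx_surj hE tT tA.
by exists x => //; rewrite xA.
Qed.

Lemma packing_bound_finite : (0 < m)%N -> finite_set [set: F] ->
  `I_(n ^ 2).+1 #<= [set: F] -> toric_packing T -> (r <= n.+1)%N.
Proof.
move=> m0 /finite_seqP[s0 sE] /card_le_uniq_seq[s1 us1 s1n] Tp.
have [h hE] := split_torusP Tp.1; pose s := undup s0.
have sP x : x \in s by rewrite mem_undup; have : [set: F] x by []; rewrite sE.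
have us : uniq s := undup_uniq s0.
have sn : (n ^ 2 < size s)%N by rewrite -s1n; exact: uniq_leq_size.
pose s' := rem 0 s; have us' : uniq s' by rewrite rem_uniq.
have s'0 (a : seq_sub s') : ssval a != 0.
  by have := ssvalP a; rewrite mem_rem_uniq // inE => /andP[].
have ss' : size s = (size s').+1 by rewrite size_rem // prednK //; apply: leq_trans sn.
pose x (f : {ffun 'I_(r * m).+1 -> seq_sub s'}) j := ssval (f j).
pose g f : {ffun 'I_n * 'I_n -> seq_sub s} :=
  [ffun ij => SeqSub (sP (product_mx h (x f) ij.1 ij.2))].
have g_inj : injective g.
  move=> f f' /ffunP ff'; have xx' : x f = x f'.
    apply: (product_mx_inj Tp hE) => [j|j|]; [exact: s'0|exact: s'0|].
    by apply/matrixP => i j; have := ff' (i, j); rewrite !ffunE => -[].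
  by apply/ffunP => j; apply: val_inj; exact: (congr1 (fun u => u j) xx').
(* For a field of order [q] the injection gives [(q - 1)^(r m + 1) <= q^(n^2)]; [r > n + 1] would
   make the exponent at least [n^2 + 1], against [ltn_expS]. *)
have := leq_card _ g_inj; rewrite !card_ffun card_prod !card_ord !card_seq_sub // ss' mulnn.
rewrite ss' ltnS in sn; have N4 : (3 < n ^ 2)%N by rewrite -mulnn; nia.
apply: contraTT; rewrite -!ltnNge => rn; apply: leq_trans (ltn_expS N4 sn) _.
by rewrite leq_pexp2l //; [apply: leq_trans sn|rewrite -mulnn; nia].
Qed.

(** If [r <= n + 1], factorizations over the covering can be conjugated into the frame tori and
    padded with 1. As the latter form a packing, this embeds the finite group into itself while
    missing [z0]. *)
Lemma covering_bound_finite : (0 < m)%N -> finite_set [set: F] ->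
  toric_covering T -> (n.+2 <= r)%N.
Proof.
move=> m0 Ffin [Ts Tc]; rewrite ltnNge; apply/negP => rn.
have [h hE] := split_torusP Ts.
have fP := @frame_std F n; have [_ Sinj] := frame_packing fP.
have [z0 z0P] := frame_packing_not_onto fP (m0 : (1 < n)%N).
have /choice[t tP] : forall z : PGL F n, exists t : {ffun 'I_r -> PGL F n},
    torus_product T t /\ mul_map t = z.
  by move=> z; have [t tT tz] := Tc z I; exists t.
have tD z i : diag_torus (conjg (t z i) (PGL_pi (h i))^-1)%g.
  have [tT _] := tP z; have := tT i; rewrite hE => -[d dD <-].
  by rewrite conjgK.
pose S i := PGL_pi (frame_basis fP i).
pose s z : {ffun 'I_n.+1 -> PGL F n} := [ffun i => if insub (val i) is Some j
  then conjg (conjg (t z j) (PGL_pi (h j))^-1)%g (S i) else 1%g].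
have sS z : torus_product (frame_torus fP) (s z).
  move=> i; rewrite ffunE; case: insubP => [j _ _|_].
    by exists (conjg (t z j) (PGL_pi (h j))^-1)%g.
  by apply/frame_torusP => j _; exact: fixes_line1.
have s_inj z z' : mul_map (s z) = mul_map (s z') -> z = z'.
  move=> /(Sinj _ _ (mem_set (sS z)) (mem_set (sS z')))/ffunP ss'.
  rewrite -(tP z).2 -(tP z').2; congr mul_map; apply/ffunP => j.
  have := ss' (widen_ord rn j); rewrite !ffunE.
  have -> : insub (val (widen_ord rn j)) = Some j by rewrite /= valK.
  by move=> /conjg_inj/conjg_inj.
have /finite_seqP[l0 lE] := finite_PGL n Ffin.
pose l := undup l0.
have lP z : z \in l by rewrite mem_undup; have : [set: PGL F n] z by []; rewrite lE.
have : uniq (z0 :: [seq mul_map (s z) | z <- l]).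
  rewrite /= map_inj_uniq ?undup_uniq ?andbT //.
  apply/negP => /mapP[z _ e]; apply: (z0P (s z) _ (esym e)) => i; exact: sS.
move=> /uniq_leq_size/(_ (fun z _ => lP z)).
by rewrite /= size_map ltnn.
Qed.

End PackingCoveringBounds.

Section ExtendedNumbers.
Variables (F : fieldType) (n : nat).
Local Open Scope ereal_scope.

Lemma packing_TPN r (T : 'I_r -> set (PGL F n)) : toric_packing T -> r%:R%:E <= TPN F n.
Proof. by move=> Tp; apply: ereal_sup_ubound; exists r => //; exists T. Qed.

Lemma covering_TCN r (T : 'I_r -> set (PGL F n)) : toric_covering T -> TCN F n <= r%:R%:E.
Proof. by move=> Tc; apply: ereal_inf_lbound; exists r => //; exists T. Qed.

Lemma TPN_le N : (forall r (T : 'I_r -> set (PGL F n)), toric_packing T -> (r <= N)%N) ->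
  TPN F n <= N%:R%:E.
Proof.
move=> H; apply: ge_ereal_sup => _ [r [T Tp] <-].
by rewrite lee_fin ler_nat; exact: H Tp.
Qed.

Lemma TCN_ge N : (forall r (T : 'I_r -> set (PGL F n)), toric_covering T -> (N <= r)%N) ->
  N%:R%:E <= TCN F n.
Proof.
move=> H; apply: le_ereal_inf_tmp => _ [r [T Tc] <-].
by rewrite lee_fin ler_nat; exact: H Tc.
Qed.

End ExtendedNumbers.

Unset Implicit Arguments.

Local Open Scope ereal_scope.

Theorem theorem1p6 (F : fieldType) (n : nat) (hn : (1 < n)%N) :
  [/\ n.+1%:R%:E <= TPN F n,
      `I_(n ^ 2).+1 #<= [set: F] -> TCN F n <= n.+2%:R%:E,
      GRing.closed_field_axiom F ->
        [/\ forall T : set (PGL F n), split_maximal_torus T ->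
              TPN F n = krull_dim [set: PGL F n] / krull_dim T,
            TPN F n = n.+1%:R%:E
          & TCN F n = n.+1%:R%:E \/ TCN F n = n.+2%:R%:E]
    & finite_set [set: F] -> `I_(n ^ 2).+1 #<= [set: F] ->
        TPN F n = n.+1%:R%:E /\ TCN F n = n.+2%:R%:E].
Proof.
case: n hn => // m m0.
have TPN_ge : m.+2%:R%:E <= TPN F m.+1.
  by have [T Tp] := packing_exists F m.+1; exact: packing_TPN Tp.
have TCN_le (s : seq F) : uniq s -> (m.+1 ^ 2 < size s)%N -> TCN F m.+1 <= m.+3%:R%:E.
  by move=> us ns; have [T Tc] := covering_exists m0 us ns; exact: covering_TCN Tc.
have TCN_le' : `I_(m.+1 ^ 2).+1 #<= [set: F] -> TCN F m.+1 <= m.+3%:R%:E.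
  by move=> /card_le_uniq_seq[s us sn]; apply: (TCN_le s) => //; rewrite sn.
split=> //.
- move=> Fcl; have Finf := closed_field_infinite Fcl.
  have TPNE : TPN F m.+1 = m.+2%:R%:E.
    apply/eqP; rewrite eq_le TPN_ge andbT; apply: TPN_le => r T.
    exact: packing_bound_closed.
  split=> //.
    move=> T Ts; rewrite TPNE (krull_dim_PGL Finf (ltn0Sn m)) (krull_dim_torus Finf (ltn0Sn m) Ts).
    have m0R : (m%:R : Rdefinitions.R) != 0%R by rewrite pnatr_eq0 -lt0n.
    rewrite /= inver (negbTE m0R) -EFinM; congr EFin.
    (* This amounts to [(n + 1) (n - 1) = n^2 - 1]. *)
    apply: (mulIf m0R); rewrite mulfVK // -natrM; congr (_%:R)%R; nia.
  have [s [us sn]] := infinite_uniq_seq (m.+1 ^ 2).+1 Finf.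
  have le : TCN F m.+1 <= m.+3%:R%:E by apply: (TCN_le s) => //; rewrite sn.
  have [[T Tc]|nT] := pselect (exists T : 'I_m.+2 -> set (PGL F m.+1), toric_covering T).
    left; apply/eqP; rewrite eq_le (covering_TCN Tc) /=; apply: TCN_ge => r T'.
    exact: covering_bound_closed.
  (* No covering has length [n + 1] and none is shorter, so all have length at least [n + 2]. *)
  right; apply/eqP; rewrite eq_le le /=; apply: TCN_ge => r T Tc.
  rewrite ltn_neqAle (covering_bound_closed m0 Fcl Tc) andbT.
  by apply: contra_notN nT => /eqP rE; move: T Tc; rewrite -rE => T Tc; exists T.
- move=> Ffin Fn; split; apply/eqP; rewrite eq_le.
    rewrite TPN_ge andbT; apply: TPN_le => r T; exact: packing_bound_finite.
  rewrite TCN_le' //=; apply: TCN_ge => r T; exact: covering_bound_finite.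
Qed.
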